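(* Assume that $\mathcal K$ satisfies (Dim) and that every definable subset of $K$ that is closed, bounded and discrete is finite. Let $\tau$ be a non-zero and non-invertible element of $\mathcal O$ (i.e. $\tau\in\mathcal O\setminus\{0\}$ and $\tau^{-1}\notin\mathcal O$). Let $X\subseteq K^m$ be a definable set of pure dimension $d\ge2$. (1) If $\mathcal O=[-1,1]$ (the ordered case), then $\mathcal C(X,\mathbb Z)$ is definable in $(\mathcal C(X),\mathcal B)$. (2) In any case (ordered or valued), $\mathcal C(X,\tau^{\mathbb Z})$ is definable in $(\mathcal C(X),\mathcal B)$.
   Context: Setting. $K$ is a field and $\mathcal O\subseteq K$ is either (ordered case) the unit interval $[-1,1]$ of a total order $\le$ making $K$ an ordered field, or (valued case) the valuation ring of a non-trivial valuation $v$ on $K$. $\mathcal K$ is an expansion of $(K,\mathcal O)$: a structure with universe $K$ in a language extending the ring language $\{0,1,+,-,\times\}$ together with a unary predicate for $\mathcal O$. ''Definable'' means first-order definable with parameters (in $\mathcal K$ for subsets of $K^m$). $\mathcal O^\times$ is the set of non-zero $a\in\mathcal O$ with $a^{-1}\in\mathcal O$; $|x|$ is the class of $x\in K^\times$ in $K^\times/\mathcal O^\times$, $|0|=0$, and $|y|\le|x|$ iff $y\in x\mathcal O$. For $x\in K^m$, $\|x\|=\max_i|x_i|$; $K^m$ carries the topology given by the open balls for $\|\cdot\|$; ''bounded'' is with respect to $\|\cdot\|$. For definable $X\subseteq K^m$, $\mathcal C(X)$ is the ring (pointwise operations) of continuous definable functions $X\to K$; $\mathcal B=\{s\in\mathcal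 C(X): s(x)\in\mathcal O\ \forall x\in X\}$; $(\mathcal C(X),\mathcal B)$ is the ring expanded by a unary predicate for $\mathcal B$. For $Y\subseteq K$, $\mathcal C(X,Y)$ is the set of $f\in\mathcal C(X)$ with $f(X)\subseteq Y$. $\tau^{\mathbb Z}=\{\tau^k:k\in\mathbb Z\}$. Dimension. A coordinate projection $K^m\to K^r$ is a map $x\mapsto(x_i)_{i\in I}$ with $I\subseteq\{1,\dots,m\}$ of size $r\ge0$. The dimension $\dim X$ of a non-empty $X\subseteq K^m$ is the maximal $r\le m$ such that $\pi(X)$ has non-empty interior for some coordinate projection $\pi:K^m\to K^r$; $\dim\emptyset=-\infty$. The local dimension is $\dim(X,x)=\min\{\dim(B\cap X): B\text{ an open ball centered at }x\}$. $X$ has pure dimension $d$ if $\dim(X,x)=d$ for all $x\in X$. $W_d(X)$ is the set of $x\in X$ for which there are an open ball $B$ centered at $x$ and a coordinate projection $\pi:K^m\to K^d$ restricting to a homeomorphism from $B\cap X$ onto an open subset of $K^d$. Write $\partial X=\overline X\setminus X$. $\mathcal K$ satisfies (Dim) if for every definable set $X\subseteq K^m$ and every definable map $f:X\to K^r$: (Dim1) $\dim f(X)\le\dim X$; (Dim2) $\dim X=\dim\overline X$, and if $X\ne\emptyset$ then $\dim\partial X<\dim X$; (Dim3) if $\dim X=d\ge0$ then $\dim(X\setminus W_d(X))<d$. *)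

(* Defs.v *)
From HB Require Import structures.
From mathcomp Require Import all_boot all_order all_algebra.
From mathcomp Require Import all_classical all_reals topology.

Set Implicit Arguments.
Unset Strict Implicit.
Unset Printing Implicit Defensive.

Import Order.TTheory GRing.Theory Num.Theory.

Local Open Scope classical_set_scope.
Local Open Scope ring_scope.

Record language := Language {
  fsymb : Type;
  farity : fsymb -> nat;
  rsymb : Type;
  rarity : rsymb -> nat
}.

Definition lang_sum (L1 L2 : language) : language := {|
  fsymb := (fsymb L1 + fsymb L2)%type;
  farity := fun f => match f with inl g => farity g | inr g => farity g end;
  rsymb := (rsymb L1 + rsymb L2)%type;
  rarity := fun s => match s with inl t => rarity t | inr t => rarity t end
|}.

(* An [interp L M] makes the type [M] into an [L]-structure. *)
Record interp (L : language) (M : Type) := Interp {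
  ifun : forall f : fsymb L, ('I_(farity f) -> M) -> M;
  irel : forall s : rsymb L, ('I_(rarity s) -> M) -> Prop
}.

Definition interp_sum (L1 L2 : language) (M : Type)
    (I1 : interp L1 M) (I2 : interp L2 M) : interp (lang_sum L1 L2) M := {|
  ifun := fun f : fsymb (lang_sum L1 L2) =>
    match f return ('I_(@farity (lang_sum L1 L2) f) -> M) -> M with
    | inl g => ifun I1 (f := g) | inr g => ifun I2 (f := g)
    end;
  irel := fun s : rsymb (lang_sum L1 L2) =>
    match s return ('I_(@rarity (lang_sum L1 L2) s) -> M) -> Prop with
    | inl t => irel I1 (s := t) | inr t => irel I2 (s := t)
    end
|}.

Inductive term (L : language) : Type :=
| Var of nat
| App (f : fsymb L) of ('I_(farity f) -> term L).

Inductive formula (L : language) : Type :=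
| FEq of term L & term L
| FRel (s : rsymb L) of ('I_(rarity s) -> term L)
| FNot of formula L
| FAnd of formula L & formula L
| FEx of formula L.

Arguments Var {L} _.

Definition scons (M : Type) (a : M) (e : nat -> M) (k : nat) : M :=
  if k is j.+1 then e j else a.

Fixpoint eval (L : language) (M : Type) (I : interp L M) (e : nat -> M)
    (t : term L) : M :=
  match t with
  | Var k => e k
  | App f args => ifun I (fun i => eval I e (args i))
  end.

(* [FEx] binds the variable 0 and shifts the others (de Bruijn indices). *)
Fixpoint sat (L : language) (M : Type) (I : interp L M) (e : nat -> M)
    (phi : formula L) : Prop :=
  match phi with
  | FEq t u => eval I e t = eval I e u
  | FRel s args => irel I (fun i => eval I e (args i))
  | FNot phi1 => ~ sat I e phi1
  | FAnd phi1 phi2 => sat I e phi1 /\ sat I e phi2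
  | FEx phi1 => exists a : M, sat I (scons a e) phi1
  end.

(* The variables 0, ..., n-1 stand for the coordinates of [p]; the remaining
   ones receive the parameters [e 0], [e 1], ... *)
Definition assign (M : Type) (n : nat) (p : 'rV[M]_n) (e : nat -> M)
    (k : nat) : M :=
  if insub k is Some i then p ord0 i else e (k - n)%N.

Definition definable (L : language) (M : Type) (I : interp L M) (n : nat)
    (S : set 'rV[M]_n) : Prop :=
  exists (phi : formula L) (e : nat -> M),
    forall p : 'rV[M]_n, S p <-> sat I (assign p e) phi.

Definition definable1 (L : language) (M : Type) (I : interp L M)
    (S : set M) : Prop :=
  definable I [set p : 'rV[M]_1 | S (p ord0 ord0)].

Inductive ring_symb := RZero | ROne | RAdd | ROpp | RMul.

Definition ring_arity (f : ring_symb) : nat :=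
  match f with RZero | ROne => 0 | ROpp => 1 | RAdd | RMul => 2 end.

Definition ring_pred_lang : language := {|
  fsymb := ring_symb;
  farity := ring_arity;
  rsymb := unit;
  rarity := fun=> 1%N
|}.

Definition ring_pred_interp (R : pzRingType) (P : set R) :
    interp ring_pred_lang R := {|
  ifun := fun f : fsymb ring_pred_lang =>
    match f return ('I_(ring_arity f) -> R) -> R with
    | RZero => fun=> 0
    | ROne => fun=> 1
    | RAdd => fun a => a ord0 + a ord_max
    | ROpp => fun a => - a ord0
    | RMul => fun a => a ord0 * a ord_max
    end;
  irel := fun _ a => P (a ord0)
|}.

(* The value at 0, which should be infinity, is left unspecified. *)
Record valuation (K : fieldType) := Valuation {
  value_group : porderZmodType;
  value_total : total (<=%O : rel value_group);
  value_leD2l : forall a b c : value_group, a <= b -> c + a <= c + b;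
  val_of : K -> value_group;
  val_ofM : forall x y, x != 0 -> y != 0 -> val_of (x * y) = val_of x + val_of y;
  val_ofD : forall x y, x != 0 -> y != 0 -> x + y != 0 ->
    Order.min (val_of x) (val_of y) <= val_of (x + y);
  val_nontrivial : exists2 x, x != 0 & val_of x != 0
}.

Inductive ov_field :=
| OrderedField of realFieldType
| ValuedField (K : fieldType) of valuation K.

Definition is_ordered (F : ov_field) : bool :=
  if F is OrderedField _ then true else false.

Definition carrier_field (F : ov_field) : fieldType :=
  match F with OrderedField R => (R : fieldType) | ValuedField K _ => K end.

Definition carrier (F : ov_field) : Type := carrier_field F.

HB.instance Definition _ (F : ov_field) :=
  GRing.Field.copy (carrier F) (carrier_field F).

(* The set O of the pair (K, O). *)
Definition unit_ball (F : ov_field) : set (carrier F) :=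
  match F return set (carrier F) with
  | OrderedField R => [set x : R | -1 <= x <= 1]
  | ValuedField K v => [set x : K | x = 0 \/ 0 <= val_of v x]
  end.

(* [vle y x] and [vlt y x] are |y| <= |x| and |y| < |x| in K/O^*. *)
Definition vle (F : ov_field) (y x : carrier F) : Prop :=
  exists2 o, unit_ball o & y = x * o.

Definition vlt (F : ov_field) (y x : carrier F) : Prop := vle y x /\ ~ vle x y.

Section OvFieldTheory.

Lemma unit_ball_ordered (R : realFieldType) (x : R) :
  @unit_ball (OrderedField R) x <-> `|x| <= 1.
Proof. by rewrite /= ler_norml. Qed.

Lemma val_of1 (K : fieldType) (v : valuation K) : val_of v 1 = 0.
Proof.
have := val_ofM v (oner_neq0 K) (oner_neq0 K).
by rewrite mulr1 => /eqP; rewrite -subr_eq0 opprD addNKr oppr_eq0 => /eqP.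
Qed.

Lemma val_ofV (K : fieldType) (v : valuation K) x :
  x != 0 -> val_of v x^-1 = - val_of v x.
Proof.
move=> x0; have := val_ofM v x0; move/(_ x^-1); rewrite invr_eq0 => /(_ x0).
rewrite divff// val_of1 => /eqP; rewrite eq_sym addrC addr_eq0.
by move=> /eqP.
Qed.

Lemma vle_ordered (R : realFieldType) (y x : R) :
  @vle (OrderedField R) y x <-> `|y| <= `|x|.
Proof.
split=> [[o /unit_ball_ordered o1 ->]|yx].
  have -> : (x : carrier (OrderedField R)) * o = (x * (o : R) : R) by [].
  by rewrite normrM ler_piMr.
have [x0|x0] := eqVneq x 0.
  move: yx; rewrite x0 normr0 normr_le0 => /eqP ->.
  exists (0 : R); first by apply/unit_ball_ordered; rewrite normr0 ler01.
  by rewrite mulr0.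
exists (y / x : R).
  by apply/unit_ball_ordered; rewrite normf_div ler_pdivrMr ?mul1r ?normr_gt0.
have : y = x * (y / x) by rewrite mulrC divfK.
by [].
Qed.

Lemma vlt_ordered (R : realFieldType) (y x : R) :
  @vlt (OrderedField R) y x <-> `|y| < `|x|.
Proof.
split=> [[_ nxy]|yx].
  by rewrite ltNge; apply/negP => /vle_ordered.
split; first exact/vle_ordered/ltW.
by move=> /vle_ordered; rewrite leNgt yx.
Qed.

Lemma value_leN (K : fieldType) (v : valuation K) (a b : value_group v) :
  (a <= b) = (0 <= b - a).
Proof.
apply/idP/idP => [/(value_leD2l (- a))|/(value_leD2l a)].
  by rewrite addNr addrC.
by rewrite addr0 addrC subrK.
Qed.

Lemma vle_valued (K : fieldType) (v : valuation K) (y x : K) :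
  @vle (ValuedField v) y x <->
  y = 0 \/ [/\ x != 0, y != 0 & val_of v x <= val_of v y].
Proof.
split=> [[o oO ->]|].
  have -> : (x : carrier (ValuedField v)) * o = (x * (o : K) : K) by [].
  have [->|x0] := eqVneq x 0; first by left; rewrite mul0r.
  have [o0|o0] := eqVneq (o : K) 0; first by left; rewrite o0 mulr0.
  right; split=> //; first by rewrite mulf_neq0.
  case: oO => [oE|o_ge0]; first by rewrite oE eqxx in o0.
  by rewrite val_ofM// value_leN addrC addKr.
case=> [->|[x0 y0 xy]].
  by exists (0 : K); [left | rewrite mulr0].
exists (y / x : K); last first.
  have : y = x * (y / x) by rewrite mulrC divfK.
  by [].
right; rewrite val_ofM ?invr_eq0// val_ofV//.
by rewrite -value_leN.
Qed.

Lemma value_leNgt (K : fieldType) (v : valuation K) (a b : value_group v) :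
  ~~ (a <= b) -> b < a.
Proof.
move=> nab; rewrite lt_neqAle; have /orP[/(negP nab)//|ba] := value_total a b.
by rewrite ba andbT; apply: contra nab => /eqP ->.
Qed.

Lemma vlt_valued (K : fieldType) (v : valuation K) (y x : K) :
  @vlt (ValuedField v) y x <->
  x != 0 /\ (y = 0 \/ y != 0 /\ val_of v x < val_of v y).
Proof.
split=> [[_ nxy]|[x0 yx]].
  have x0 : x != 0 by apply/eqP => x0; apply/nxy/vle_valued; left.
  split=> //; have [y0|y0] := eqVneq y 0; [by left|right; split=> //].
  by apply: value_leNgt; apply/negP => yx; apply/nxy/vle_valued; right.
split.
  by apply/vle_valued; case: yx => [|[y0 /ltW]]; [left|right].
move=> /vle_valued[xE|[y0 _ yx']]; first by rewrite xE eqxx in x0.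
case: yx => [yE|[_]]; first by rewrite yE eqxx in y0.
by rewrite lt_neqAle => /andP[/negP + xy]; apply; rewrite eq_le xy.
Qed.

Variable F : ov_field.
Implicit Types x y z r s a b : carrier F.

Lemma vlt_neq0 y r : vlt y r -> r != 0.
Proof.
by move=> [[o _ ->] nr]; apply/eqP => r0; apply: nr; rewrite r0 mul0r; exists 1;
  [case: (F) => [R|K v] /=; [rewrite lexx (le_trans (lerN10 R) ler01) |
     right; rewrite val_of1] | rewrite mul0r].
Qed.

Lemma vlt0 r : r != 0 -> vlt 0 r.
Proof.
case: F r => [R|K v] r r0; first by apply/vlt_ordered; rewrite normr0 normr_gt0.
by apply/vlt_valued; split=> //; left.
Qed.

Lemma vlt_min r s : r != 0 -> s != 0 ->
  exists2 t, t != 0 & forall x, vlt x t -> vlt x r /\ vlt x s.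
Proof.
case: F r s => [R|K v] r s r0 s0.
  exists (Order.min `|r| `|s| : R).
    by case: (leP `|r| `|s|); rewrite normr_eq0.
  have m0 : 0 <= Order.min `|r| `|s| by rewrite le_min !normr_ge0.
  move=> x /vlt_ordered; rewrite (ger0_norm m0) lt_min.
  by move=> /andP[? ?]; split; exact/vlt_ordered.
have [rs|/value_leNgt/ltW sr] := boolP (val_of v r <= val_of v s).
  exists s => // x /vlt_valued[_ xs]; split; apply/vlt_valued; split=> //.
  by case: xs => [|[? sx]]; [left|right; split => //; exact: le_lt_trans sx].
exists r => // x /vlt_valued[_ xs]; split; apply/vlt_valued; split=> //.
by case: xs => [|[? sx]]; [left|right; split => //; exact: le_lt_trans sx].
Qed.

Lemma vlt_open y r : vlt y r ->
  exists2 s, s != 0 & forall x, vlt x s -> vlt (y + x) r.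
Proof.
move=> yr; have := vlt_neq0 yr; move: yr; case: F y r => [R|K v] y r.
  move=> /vlt_ordered yr r0; exists (`|r| - `|y| : R).
    by apply: lt0r_neq0; rewrite subr_gt0.
  have m0 : 0 <= `|r| - `|y| by rewrite subr_ge0; exact: ltW.
  move=> x /vlt_ordered; rewrite (ger0_norm m0) => xs.
  apply/vlt_ordered; apply: le_lt_trans (ler_normD (y : R) (x : R)) _.
  by rewrite addrC -ltrBrDr.
move=> /vlt_valued[_ yr] r0; exists r => // x /vlt_valued[_ xr].
apply/vlt_valued; split=> //.
case: yr => [->|[y0 yr]].
  have -> : (0 : carrier (ValuedField v)) + x = x by exact: add0r.
  exact: xr.
case: xr => [->|[x0 xr]].
  have -> : (y : carrier (ValuedField v)) + 0 = y by exact: addr0.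
  by right.
have [xy0|xy0] := eqVneq (y + x : K) 0; [by left|right; split=> //].
have := val_ofD v y0 x0 xy0; apply: lt_le_trans.
by rewrite /Order.min; case: ifP.
Qed.

Lemma vlt_add r : r != 0 ->
  exists2 s, s != 0 & forall x y, vlt x s -> vlt y s -> vlt (x + y) r.
Proof.
case: F r => [R|K v] r r0.
  exists (r / 2%:R : R); first by rewrite mulf_neq0// invr_eq0 pnatr_eq0.
  move=> x y /vlt_ordered + /vlt_ordered.
  rewrite normf_div (ger0_norm (ler0n _ _)) => xr yr; apply/vlt_ordered.
  apply: le_lt_trans (ler_normD (x : R) (y : R)) _.
  by rewrite [ltRHS](splitr `|r|) ltrD.
exists r => // x y /vlt_valued[_ xr] /vlt_valued[_ yr].
apply/vlt_valued; split=> //.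
case: yr => [->|[y0 yr]].
  have -> : (x : carrier (ValuedField v)) + 0 = x by exact: addr0.
  exact: xr.
case: xr => [->|[x0 xr]].
  have -> : (0 : carrier (ValuedField v)) + y = y by exact: add0r.
  by right.
have [xy0|xy0] := eqVneq (x + y : K) 0; [by left|right; split=> //].
have := val_ofD v x0 y0 xy0; apply: lt_le_trans.
by rewrite /Order.min; case: ifP.
Qed.

Lemma vlt_mulr a r : r != 0 ->
  exists2 s, s != 0 & forall x, vlt x s -> vlt (a * x) r.
Proof.
move=> r0; have [->|a0] := eqVneq a 0.
  by exists 1 => [|x _]; [exact: oner_neq0|rewrite mul0r; exact: vlt0].
exists (r / a) => [|x [[o oO xE] nx]]; first by rewrite mulf_neq0// invr_eq0.
split; first by exists o => //; rewrite xE mulrA mulrCA mulfV// mulr1.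
move=> [o' oO' rE]; apply: nx; exists o' => //.
by rewrite rE [a * x]mulrC mulrAC mulfK.
Qed.

Lemma vlt_mul r : r != 0 ->
  exists2 s, s != 0 & forall x y, vlt x s -> vlt y s -> vlt (x * y) r.
Proof.
move=> r0; have [s s0 sr] := vlt_min (oner_neq0 (carrier F)) r0; exists s => //.
move=> x y /sr[x1 _] /sr[_ yr]; move: r r0 x y x1 yr {s s0 sr}.
case: F => [R|K v] r r0 x y.
  move=> /vlt_ordered; rewrite normr1 => x1 /vlt_ordered yr; apply/vlt_ordered.
  rewrite [ltLHS](normrM (x : R) (y : R)); apply: le_lt_trans yr.
  by rewrite ler_piMl// ltW.
move=> /vlt_valued[_ x1] /vlt_valued[_ yr]; apply/vlt_valued; split=> //.
suff: (x * y : K) = 0 \/ (x * y : K) != 0 /\ val_of v r < val_of v (x * y : K) by [].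
case: x1 => [->|[x0]]; first by left; rewrite mul0r.
rewrite val_of1 => x1; case: yr => [->|[y0 yr]]; first by left; rewrite mulr0.
right; split; first by rewrite mulf_neq0.
rewrite val_ofM//; apply: lt_le_trans yr _.
by rewrite value_leN addrK; exact: ltW.
Qed.

End OvFieldTheory.

Definition carrier_nbhs (F : ov_field) (x : carrier F) : set_system (carrier F) :=
  filter_from [set r : carrier F | r != 0] (fun r => [set y | vlt (y - x) r]).

HB.instance Definition _ (F : ov_field) :=
  hasNbhs.Build (carrier F) (@carrier_nbhs F).

Section OvFieldTopology.
Variable F : ov_field.
Implicit Types x r : carrier F.

Let nbhs_proper x : ProperFilter (nbhs x).
Proof.
apply: filter_from_proper => [|r r0]; last by exists x; rewrite /= subrr; exact: vlt0.
apply: filter_from_filter => [|r s r0 s0]; first by exists 1; exact: oner_neq0.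
have [t t0 trs] := vlt_min r0 s0; exists t => // y /trs[? ?]; split => //.
Qed.

Let nbhs_self x (A : set (carrier F)) : nbhs x A -> A x.
Proof. by move=> [r r0]; apply; rewrite /= subrr; exact: vlt0. Qed.

Let nbhs_open x (A : set (carrier F)) : nbhs x A -> nbhs x (nbhs^~ A).
Proof.
move=> [r r0 rA]; exists r => // y /= /vlt_open[s s0 sr]; exists s => // z /= /sr.
by rewrite addrC subrKA => /rA.
Qed.

HB.instance Definition _ := Nbhs_isNbhsTopological.Build (carrier F)
  nbhs_proper nbhs_self nbhs_open.

End OvFieldTopology.

Section OvFieldContinuity.
Variables (F : ov_field) (T : topologicalType).
Implicit Types f g : T -> carrier F.

Lemma carrier_continuousB f g :
  continuous f -> continuous g -> continuous (f - g).
Proof.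
move=> cf cg x A [r r0 rA].
have [s s0 sr] := vlt_add r0.
have [t t0 ts] := vlt_mulr (-1) s0.
have nf : nbhs (f x) [set y | vlt (y - f x) s] by exists s.
have ng : nbhs (g x) [set y | vlt (y - g x) t] by exists t.
have {}nf : nbhs x (f @^-1` _) := cf x _ nf.
have {}ng : nbhs x (g @^-1` _) := cg x _ ng.
suff: nbhs x ((f - g) @^-1` A) by [].
apply: filterS (filterI nf ng) => z [/= fz gz]; apply: rA => /=.
have := sr _ _ fz (ts _ gz); rewrite mulN1r !fctE.
by rewrite !opprB [g x - g z]addrC addrACA [- f x + _]addrC.
Qed.

Lemma carrier_continuousM f g :
  continuous f -> continuous g -> continuous (f * g).
Proof.
move=> cf cg x A [r r0 rA].
have [s s0 sr] := vlt_add r0.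
have [s' s'0 s's] := vlt_add s0.
have [t1 t10 t1s] := vlt_mulr (g x) s0.
have [t2 t20 t2s] := vlt_mulr (f x) s'0.
have [t3 t30 t3s] := vlt_mul s'0.
have [u u0 ut] := vlt_min t10 t30.
have [w w0 wt] := vlt_min t20 t30.
have nf : nbhs (f x) [set y | vlt (y - f x) u] by exists u.
have ng : nbhs (g x) [set y | vlt (y - g x) w] by exists w.
have {}nf : nbhs x (f @^-1` _) := cf x _ nf.
have {}ng : nbhs x (g @^-1` _) := cg x _ ng.
suff: nbhs x ((f * g) @^-1` A) by [].
apply: filterS (filterI nf ng) => z [/= /ut[f1 f3] /wt[g2 g3]]; apply: rA => /=.
have := sr _ _ (t1s _ f1) (s's _ _ (t2s _ g2) (t3s _ _ f3 g3)); rewrite !fctE.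
rewrite -mulrDl [f x + _]addrC subrK [g x * _]mulrC mulrBl mulrBr.
by rewrite addrC addrA subrK.
Qed.

End OvFieldContinuity.

(* ||y - x|| < |r|, the norm being the maximum over the coordinates. *)
Definition oball (F : ov_field) (m : nat) (x : 'rV[carrier F]_m)
    (r : carrier F) : set 'rV[carrier F]_m :=
  [set y | forall i, vlt (y ord0 i - x ord0 i) r].

(* The library topology on row vectors is the one given by the open balls. *)
Lemma nbhs_oball (F : ov_field) (m : nat) (x : 'rV[carrier F]_m)
    (A : set 'rV[carrier F]_m) :
  nbhs x A <-> exists2 r, r != 0 & oball x r `<=` A.
Proof.
split=> [[P nP PA]|[r r0 rA]]; last first.
  exists (fun i j => [set y | vlt (y - x i j) r]) => [i j|y yP]; first by exists r.
  by apply: rA => i; exact: yP.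
suff [r r0 rP] : exists2 r, r != 0 &
    forall i, i \in enum 'I_m -> forall y, vlt (y - x ord0 i) r -> P ord0 i y.
  exists r => // y yr; apply: PA => i j; rewrite (ord1 i).
  by apply: rP; rewrite ?mem_enum.
elim: (enum 'I_m) => [|i s [r r0 rs]]; first by exists 1; [exact: oner_neq0|].
have [t t0 tP] := nP ord0 i.
have [u u0 ut] := vlt_min t0 r0; exists u => // j; rewrite inE.
case/predU1P => [->|js] y /ut[? ?]; first exact: tP.
exact: rs.
Qed.

Definition ov_bounded (F : ov_field) (S : set (carrier F)) : Prop :=
  exists r : carrier F, forall x, S x -> vle x r.

Definition coord_proj (F : ov_field) (m : nat) (I : {set 'I_m})
    (x : 'rV[carrier F]_m) : 'rV[carrier F]_#|I| :=
  \row_j x ord0 (enum_val j).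

(* The dimension of the empty set is -oo. For non-empty [X] the maximum is over
   a non-empty family, as [I = set0] projects [X] onto the point K^0. *)
Definition dim (F : ov_field) (m : nat) (X : set 'rV[carrier F]_m) : \bar int :=
  if `[< X = set0 >] then -oo%E
  else ((\max_(I : {set 'I_m} | `[< (coord_proj I @` X)° !=set0 >]) #|I|)%N%:Z)%:E.

(* [e] is the minimum of the dimensions of the sets B `&` X. *)
Definition is_local_dim (F : ov_field) (m : nat) (X : set 'rV[carrier F]_m)
    (x : 'rV[carrier F]_m) (e : \bar int) : Prop :=
  (exists2 r, r != 0 & dim (oball x r `&` X) = e) /\
  (forall r, r != 0 -> (e <= dim (oball x r `&` X))%E).

Definition pure_dim (F : ov_field) (m : nat) (X : set 'rV[carrier F]_m)
    (d : nat) : Prop :=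
  forall x, X x -> is_local_dim X x (d%:Z)%:E.

Definition homeomorphism_on (S T : topologicalType) (A : set S) (B : set T)
    (f : S -> T) : Prop :=
  set_bij A B f /\ {within A, continuous f} /\
  exists g : T -> S, {in A, cancel f g} /\ {within B, continuous g}.

Definition W_ (F : ov_field) (m d : nat) (X : set 'rV[carrier F]_m) :
    set 'rV[carrier F]_m :=
  [set x | X x /\ exists (r : carrier F) (I : {set 'I_m})
      (U : set 'rV[carrier F]_#|I|),
    [/\ r != 0, #|I| = d, open U &
        homeomorphism_on (oball x r `&` X) U (coord_proj I)]].

Definition frontier (T : topologicalType) (X : set T) : set T := closure X `\` X.

(* The language of an expansion is the disjoint union of the ring language
   with a predicate for O and of an arbitrary language. *)
Record expansion (F : ov_field) := Expansion {
  extra_lang : language;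
  extra_interp : interp extra_lang (carrier F)
}.

Definition full_interp (F : ov_field) (E : expansion F) :
    interp (lang_sum ring_pred_lang (extra_lang E)) (carrier F) :=
  interp_sum (ring_pred_interp (@unit_ball F)) (extra_interp E).

Record defset (F : ov_field) (E : expansion F) (m : nat) := DefSet {
  defset_set :> set 'rV[carrier F]_m;
  defsetP : definable (full_interp E) defset_set
}.

Definition definable_fun (F : ov_field) (E : expansion F) (m r : nat)
    (X : set 'rV[carrier F]_m) (f : X -> 'rV[carrier F]_r) : Prop :=
  definable (full_interp E)
    [set p : 'rV[carrier F]_(m + r) | exists x : X, p = row_mx (val x) (f x)].

Definition satisfies_Dim (F : ov_field) (E : expansion F) : Prop :=
  forall (m : nat) (X : defset E m),
  [/\ forall (r : nat) (f : X -> 'rV[carrier F]_r),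
        definable_fun E f -> (dim (range f) <= dim X)%E,
      dim X = dim (closure X),
      X !=set0 -> (dim (frontier X) < dim X)%E &
      forall d : nat, dim X = (d%:Z)%:E -> (dim (X `\` W_ d X) < (d%:Z)%:E)%E].

Definition cont_def (F : ov_field) (E : expansion F) (m : nat) (X : defset E m) :
    {pred (X -> carrier F)} :=
  fun f => `[< continuous f /\
               definable_fun E (fun x : X => const_mx (f x) : 'rV_1) >].
Arguments cont_def {F E m} X.

Section ContDefSubring.

Lemma assign_ord (M : Type) n (p : 'rV[M]_n) e (i : 'I_n) :
  assign p e i = p ord0 i.
Proof. by rewrite /assign valK. Qed.

Lemma assign_add (M : Type) n (p : 'rV[M]_n) e k : assign p e (n + k) = e k.
Proof. by rewrite /assign insubF ?addKn// ltnNge leq_addr. Qed.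

Section Renaming.
Variable L : language.

Fixpoint rent (s : nat -> nat) (t : term L) : term L :=
  match t with
  | Var k => Var (s k)
  | App f args => App (fun i => rent s (args i))
  end.

Definition up (s : nat -> nat) (k : nat) : nat := if k is j.+1 then (s j).+1 else 0%N.

Fixpoint renf (s : nat -> nat) (phi : formula L) : formula L :=
  match phi with
  | FEq t u => FEq (rent s t) (rent s u)
  | FRel r args => FRel (fun i => rent s (args i))
  | FNot phi1 => FNot (renf s phi1)
  | FAnd phi1 phi2 => FAnd (renf s phi1) (renf s phi2)
  | FEx phi1 => FEx (renf (up s) phi1)
  end.

Variables (M : Type) (I : interp L M).

Lemma eval_rent s e t : eval I e (rent s t) = eval I (e \o s) t.
Proof. by elim: t => //= f args IH; congr (ifun _ _); apply/funext. Qed.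

Lemma sat_renf s e phi : sat I e (renf s phi) <-> sat I (e \o s) phi.
Proof.
elim: phi s e => [t u|r args|phi IH|phi IH psi IH'|phi IH] s e /=.
- by rewrite !eval_rent.
- by under eq_fun do rewrite eval_rent.
- by rewrite IH.
- by rewrite IH IH'.
- have up_scons a : scons a e \o up s = scons a (e \o s) by apply/funext; case.
  by split=> -[a Ha]; exists a; move: Ha; rewrite IH up_scons.
Qed.

End Renaming.

Variables (F : ov_field) (E : expansion F) (m : nat) (X : defset E m).
Implicit Types f g : X -> carrier F.

Let L := lang_sum ring_pred_lang (extra_lang E).
Let I := full_interp E.
Let graph f : set 'rV[carrier F]_(m + 1) :=
  [set p | exists x : X, p = row_mx (val x) (const_mx (f x))].

Let graphP f (a : 'rV[carrier F]_m) u :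
  graph f (row_mx a (const_mx u)) <-> exists x : X, val x = a /\ f x = u.
Proof.
split=> -[x]; last by move=> [<- <-]; exists x.
move=> /eq_row_mx[-> /matrixP/(_ ord0 ord0)]; rewrite !mxE => ->.
by exists x.
Qed.

Let assign_last (p : 'rV[carrier F]_(m + 1)) e :
  assign p e m = p ord0 (rshift m ord0).
Proof. by rewrite -(assign_ord p e) /= addn0. Qed.

Let row1 (p : 'rV[carrier F]_(m + 1)) :
  p = row_mx (lsubmx p) (const_mx (p ord0 (rshift m ord0))).
Proof.
rewrite -[LHS]hsubmxK; congr row_mx; apply/matrixP => i j.
by rewrite !mxE !ord1.
Qed.

(* Renaming of the variables of the graph of a function: the value is sent to
   the bound variable [b] and the parameters to those of parity [c]. *)
Let ren (b : nat) (c : bool) (k : nat) : nat :=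
  (if k < m then k.+2 else if k == m then b
   else (m + 1 + (c + (k - m).-1.*2)).+2)%N.

Let mix (e1 e2 : nat -> carrier F) (k : nat) := if odd k then e2 k./2 else e1 k./2.

Let env e1 e2 (p : 'rV[carrier F]_(m + 1)) u v :=
  scons v (scons u (assign p (mix e1 e2))).

Let ren_env (b : bool) e1 e2 (p : 'rV[carrier F]_(m + 1)) u v :
  env e1 e2 p u v \o ren (~~ b) b =
  assign (row_mx (lsubmx p) (const_mx (if b then v else u)) : 'rV_(m + 1))
    (if b then e2 else e1).
Proof.
apply/funext => k /=; rewrite /ren; have [km|] := ltnP k m.
  apply: (etrans (assign_ord p _ (lshift 1 (Ordinal km)))).
  apply/esym/(etrans (assign_ord _ _ (lshift 1 (Ordinal km)))).
  by rewrite row_mxEl mxE.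
rewrite leq_eqVlt => /predU1P[<-|mk].
  by rewrite eqxx assign_last row_mxEr mxE; case: (b).
rewrite gtn_eqF// /env /=.
have {2}-> : k = (m + 1 + (k - m).-1)%N by rewrite addn1 -subnS subnKC.
rewrite !assign_add /mix oddD odd_double addbF; case: b => /=.
  by rewrite uphalf_double.
by rewrite doubleK.
Qed.

Let def_op f g (t : term L) (h : X -> carrier F) :
  (forall e u v, eval I (scons v (scons u e)) t =
                 eval I (scons v (scons u (fun=> 0))) t) ->
  (forall x, h x = eval I (scons (g x) (scons (f x) (fun=> 0))) t) ->
  definable I (graph f) -> definable I (graph g) -> definable I (graph h).
Proof.
move=> te ht [phi [e1 fphi]] [psi [e2 gpsi]].
exists (FEx (FEx (FAnd (renf (ren 1 false) phi)
  (FAnd (renf (ren 0 true) psi) (FEq (Var m.+2) t))))), (mix e1 e2) => p.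
have zE u v : eval I (env e1 e2 p u v) (Var m.+2) = p ord0 (rshift m ord0).
  exact: assign_last.
split=> [|/= [u [v [+ [+]]]]].
  rewrite {1}(row1 p) => /graphP[x [xp hx]] /=; exists (f x), (g x).
  split; [|split].
  - apply/sat_renf; rewrite (ren_env false); apply/fphi/graphP.
    by exists x.
  - apply/sat_renf; rewrite (ren_env true); apply/gpsi/graphP.
    by exists x.
  - by rewrite -[LHS]/(eval I (env e1 e2 p (f x) (g x)) (Var m.+2)) zE// te -ht.
move=> /sat_renf; rewrite (ren_env false) => /fphi/graphP[x [xp <-]].
move=> /sat_renf; rewrite (ren_env true) => /gpsi/graphP[y [yp <-]].
have -> : y = x by apply/val_inj; rewrite xp.
rewrite -[LHS]/(eval I (env e1 e2 p (f x) (g x)) (Var m.+2)) zE// te -ht => hx.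
by rewrite (row1 p); apply/graphP; exists x.
Qed.

Lemma cont_def_subring : subring_closed (cont_def X).
Proof.
split=> [|f g|f g].
- apply/asboolP; split.
    exact: cst_continuous.
  have [phi [e Xphi]] := defsetP X.
  exists (FAnd (renf (fun k => if (k < m)%N then k else k.+1) phi)
    (FEq (Var m) (@App L (inl ROne) (fun=> Var 0)))), e => p /=.
  rewrite assign_last.
  have renE : assign p e \o (fun k => if (k < m)%N then k else k.+1) =
      assign (lsubmx p) e.
    apply/funext => k /=; have [km|mk] := ltnP k m.
      apply: (etrans (assign_ord p _ (lshift 1 (Ordinal km)))).
      by apply/esym/(etrans (assign_ord _ _ (Ordinal km))); rewrite mxE.
    rewrite -(subnKC mk) assign_add.
    by rewrite -(assign_add p e (k - m)); congr assign; rewrite -addnA add1n addnS.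
  rewrite sat_renf renE -Xphi; split.
    rewrite {1}(row1 p) => /(@graphP (cst 1))[x [<- <-]]; split => //.
    by case: x => /= x; rewrite inE.
  move=> [Xp p1]; rewrite (row1 p); apply/(@graphP (cst 1)).
  by exists (SigSub (mem_set Xp)).
- move=> /asboolP[cf df] /asboolP[cg dg]; apply/asboolP; split.
    exact: carrier_continuousB.
  apply: (@def_op f g (@App L (inl RAdd) (fun i => if val i == 0%N then Var 1
    else @App L (inl ROpp) (fun=> Var 0)))) df dg => //.
- move=> /asboolP[cf df] /asboolP[cg dg]; apply/asboolP; split.
    exact: carrier_continuousM.
  apply: (@def_op f g (@App L (inl RMul) (fun i => if val i == 0%N then Var 1
    else Var 0))) df dg => //.
Qed.

End ContDefSubring.

(* The ring C(X). *)
Record contC (F : ov_field) (E : expansion F) (m : nat) (X : defset E m) :=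
  ContC { contC_fun :> X -> carrier F; contC_funP : contC_fun \in cont_def X }.

HB.instance Definition _ (F : ov_field) (E : expansion F) (m : nat)
    (X : defset E m) := [isSub for @contC_fun F E m X].
HB.instance Definition _ (F : ov_field) (E : expansion F) (m : nat)
    (X : defset E m) := [Choice of contC X by <:].
HB.instance Definition _ (F : ov_field) (E : expansion F) (m : nat)
    (X : defset E m) :=
  GRing.SubChoice_isSubComPzRing.Build (X -> carrier F) (cont_def X) (contC X)
    (cont_def_subring X).

Definition contC_into (F : ov_field) (E : expansion F) (m : nat)
    (X : defset E m) (Y : set (carrier F)) : set (contC X) :=
  [set f | range f `<=` Y].
Arguments contC_into {F E m} X Y.

(* The structure (C(X), B), with B = C(X, O). *)
Definition contC_interp (F : ov_field) (E : expansion F) (m : nat)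
    (X : defset E m) : interp ring_pred_lang (contC X) :=
  ring_pred_interp (contC_into X (@unit_ball F)).
Arguments contC_interp {F E m} X.

(* Main.v *)
Require Import Defs.
From mathcomp Require Import all_boot all_order all_algebra ring.
From mathcomp Require Import all_classical all_reals topology.

Set Implicit Arguments.
Unset Strict Implicit.
Unset Printing Implicit Defensive.

Import Order.TTheory GRing.Theory Num.Theory.

Local Open Scope classical_set_scope.
Local Open Scope ring_scope.

(** The points of X are coded in C(X) by the functions vanishing at exactly one
    point, because two functions have a common zero if and only if they do not
    generate the unit ideal. Hence evaluation at a point, and the comparison of
    absolute values there, are definable in (C(X), B).

    Given s, g and h in C(X), the set of limits at a point x of g/h along the
    zeros of s is a definable closed subset of K, and "f(x) belongs to it" is
    definable in (C(X), B). If it is bounded and discrete then it is finite.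
    Conversely, if X has at least two independent local coordinates u and v at
    x, vanishing at x, then the slopes of the lines v = a u that form the zero
    set of the product of the v - a u are an arbitrary finite set, and by (Dim)
    such x are dense as d >= 2. So f(x) lies in the orbit of c under the affine
    map z |-> a z + b iff some finite set of slopes at x contains c and is closed
    under that map except at f(x). This applies to z + 1 and z - 1 on the orbit
    of 0, giving Z, and to tau z and z / tau on the orbit of 1, giving tau^Z.
    Both are so discrete that it is enough to check f(x) on a dense set. *)

(** * Definability with parameters *)

Section DefinablePredicates.
Variables (L : language) (M : Type) (I : interp L M).

Definition interleave (e q : nat -> M) (k : nat) : M :=
  if odd k then q k./2 else e k./2.

Lemma interleave_even e q k : interleave e q k.*2 = e k.
Proof. by rewrite /interleave odd_double doubleK. Qed.

Lemma interleave_odd e q k : interleave e q k.*2.+1 = q k.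
Proof. by rewrite /interleave /= odd_double /= uphalf_double. Qed.

(* The parameters [q] sit at the odd variables, so that the even ones remain
   available for the arguments and for the quantified variables. *)
Definition dpred (P : (nat -> M) -> Prop) : Prop :=
  exists (phi : formula L) (q : nat -> M),
    forall e, P e <-> sat I (interleave e q) phi.

Definition dterm (t : (nat -> M) -> M) : Prop :=
  exists (u : term L) (q : nat -> M),
    forall e, t e = Defs.eval I (interleave e q) u.

(** Two formulas with parameters [q1] and [q2] are put over the single sequence [interleave q1 q2]:
    the parameter of index j moves to index 2j + b. *)
Let widen (b : bool) (k : nat) : nat :=
  if odd k then (k./2.*2 + b).*2.+1 else k.

Let widenE b (e q1 q2 : nat -> M) :
  interleave e (interleave q1 q2) \o widen b =
  interleave e (if b then q2 else q1).
Proof.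
apply/funext => k; rewrite /= /widen; case: ifP => kO.
  rewrite interleave_odd; have -> : k = k./2.*2.+1.
    by rewrite -[LHS]odd_double_half kO.
  rewrite interleave_odd /= uphalf_double; case: b.
    by rewrite addn1 interleave_odd.
  by rewrite addn0 interleave_even.
by rewrite /interleave kO.
Qed.

Lemma dpred_iff (P Q : (nat -> M) -> Prop) :
  (forall e, P e <-> Q e) -> dpred Q -> dpred P.
Proof. by move=> PQ [phi [q Qphi]]; exists phi, q => e; rewrite PQ. Qed.

Lemma dpred_not P : dpred P -> dpred (fun e => ~ P e).
Proof. by move=> [phi [q Pphi]]; exists (FNot phi), q => e /=; rewrite Pphi. Qed.

Lemma dpred_and P Q : dpred P -> dpred Q -> dpred (fun e => P e /\ Q e).
Proof.
move=> [phi [q Pphi]] [psi [q' Qpsi]].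
exists (FAnd (renf (widen false) phi) (renf (widen true) psi)).
exists (interleave q q') => e /=.
by rewrite !sat_renf !widenE Pphi Qpsi.
Qed.

Lemma dpred_ex (Q : M -> (nat -> M) -> Prop) :
  dpred (fun e => Q (e 0%N) (fun k => e k.+1)) -> dpred (fun e => exists a, Q a e).
Proof.
move=> [phi [q Qphi]].
(* Under the binder every old variable moves up by one. Parameters keep their index, hence the shift
   to [k.+1]; an argument has moved two even places to make room for the new variable 0, hence
   [j.+2] to [j.+1]. *)
pose s k := if odd k then k.+1 else if k is j.+2 then j.+1 else 0%N.
exists (FEx (renf s phi)), q => e /=.
have sE a : scons a (interleave e q) \o s = interleave (scons a e) q.
  apply/funext => -[//|[//|k]]; rewrite /= /s /interleave /= negbK.
  by case: ifP => /= kO; rewrite /scons ?negbK kO.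
by split=> -[a Qa]; exists a; move: Qa; rewrite sat_renf sE -Qphi.
Qed.

Lemma dpred_or P Q : dpred P -> dpred Q -> dpred (fun e => P e \/ Q e).
Proof.
move=> dP dQ; apply: (dpred_iff (Q := fun e => ~ (~ P e /\ ~ Q e))).
  move=> e; split=> [[?|?] []//|nPQ].
  by apply: contrapT => /not_orP nPQ'; exact: nPQ.
by apply: dpred_not; apply: dpred_and; exact: dpred_not.
Qed.

Lemma dpred_imp P Q : dpred P -> dpred Q -> dpred (fun e => P e -> Q e).
Proof.
move=> dP dQ; apply: (dpred_iff (Q := fun e => ~ P e \/ Q e)).
  by move=> e; rewrite implyE.
by apply: dpred_or => //; exact: dpred_not.
Qed.

Lemma dpred_all (Q : M -> (nat -> M) -> Prop) :
  dpred (fun e => Q (e 0%N) (fun k => e k.+1)) -> dpred (fun e => forall a, Q a e).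
Proof.
move=> dQ; apply: (dpred_iff (Q := fun e => ~ exists a, ~ Q a e)).
  move=> e; split=> [Qe [a]|nQ a]; first exact.
  by apply: contrapT => nQa; apply: nQ; exists a.
by apply/dpred_not/(@dpred_ex (fun a e => ~ Q a e))/dpred_not.
Qed.

Lemma dpred_eq t u : dterm t -> dterm u -> dpred (fun e => t e = u e).
Proof.
move=> [t' [q tE]] [u' [q' uE]].
exists (FEq (rent (widen false) t') (rent (widen true) u')).
exists (interleave q q') => e /=.
by rewrite !eval_rent !widenE tE uE.
Qed.

Lemma dpred_const (c : Prop) : M -> dpred (fun=> c).
Proof.
move=> a; have T : dpred (fun=> True) by exists (FEq (Var 0) (Var 0)), (fun=> a).
have [Hc|Hc] := pselect c; first by apply: dpred_iff T => e; split.
by apply: dpred_iff (dpred_not T) => e; split=> // /(_ Logic.I).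
Qed.

Lemma dterm_var k : M -> dterm (fun e => e k).
Proof.
move=> a; exists (Var k.*2), (fun=> a) => e /=.
by rewrite /interleave odd_double doubleK.
Qed.

Lemma dterm_const a : dterm (fun=> a).
Proof. by exists (Var 1), (fun=> a). Qed.

Lemma dpred_all_ord n (P : 'I_n -> (nat -> M) -> Prop) : M ->
  (forall i, dpred (P i)) -> dpred (fun e => forall i, P i e).
Proof.
move=> a; elim: n P => [|n IH] P dP.
  by apply: dpred_iff (dpred_const True a) => e; split => // _ [].
apply: (dpred_iff (Q := fun e => P ord0 e /\ forall i, P (lift ord0 i) e)).
  move=> e; split=> [Pe|[P0 PS] i]; first by split.
  by case: (unliftP ord0 i) => [j ->|->].
by apply: dpred_and => //; apply: IH.
Qed.

Lemma dpred_exrow n (Q : 'rV[M]_n -> (nat -> M) -> Prop) : M ->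
  dpred (fun e => Q (\row_(i < n) e i) (fun k => e (n + k)%N)) ->
  dpred (fun e => exists y, Q y e).
Proof.
move=> a0; elim: n Q => [|n IH] Q dQ.
  apply: dpred_iff dQ => e; split=> [[y Qy]|Q0].
    suff -> : \row_(i < 0) e i = y by [].
    by apply/matrixP => i [].
  by exists (\row_(i < 0) e i).
(* The last coordinate is quantified first, so that the n inner quantifiers push it to the variable
   n. *)
pose Q' (y : 'rV[M]_n) (e : nat -> M) :=
  Q (\row_(i < n.+1) (if unlift ord_max i is Some j then y ord0 j else e 0%N))
    (fun k => e k.+1).
apply: (dpred_iff (Q := fun e => exists a y, Q' y (scons a e))).
  move=> e; split=> [[y Qy]|[a [y Qy]]]; last by eexists; exact: Qy.
  exists (y ord0 ord_max), (\row_j y ord0 (lift ord_max j)); rewrite /Q' /=.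
  set z := (\row_i _); suff -> : z = y by [].
  apply/matrixP => i j; rewrite ord1 mxE; case: unliftP => [k|] -> //.
  by rewrite mxE.
apply: (@dpred_ex (fun a e => exists y, Q' y (scons a e))).
apply: (IH (fun y e => Q' y (scons (e 0%N) (fun k => e k.+1)))).
move: dQ; apply: dpred_iff => e; rewrite /Q' /=.
set y := \row_i _; set z := \row_i _; have -> : y = z.
  apply/matrixP => i j; rewrite !mxE; case: unliftP => [k|] ->.
    by rewrite mxE lift_max.
  by rewrite addn0.
by under eq_fun do rewrite addnS -addSn.
Qed.

Lemma dpred_definable n (S : set 'rV[M]_n) :
  dpred (fun e => S (\row_(i < n) e i)) -> definable I S.
Proof.
move=> [phi [q Sphi]].
(* Even variables beyond the n coordinates are all sent to the variable n, which holds [q 0]; the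
   set depends on the first n only. *)
pose s k := if odd k then (n + k./2)%N else if (k./2 < n)%N then k./2 else n.
exists (renf s phi), q => p; rewrite sat_renf.
pose e k := assign p q (if (k < n)%N then k else n).
have -> : p = \row_(i < n) e i.
  by apply/matrixP => i j; rewrite ord1 mxE /e ltn_ord assign_ord.
rewrite Sphi; suff -> : assign (\row_(i < n) e i) q \o s = interleave e q by [].
have -> : \row_(i < n) e i = p.
  by apply/matrixP => i j; rewrite ord1 mxE /e ltn_ord assign_ord.
apply/funext => k /=; rewrite /s /interleave; case: ifP => _.
  by rewrite assign_add.
by rewrite /e; case: ifP.
Qed.

Lemma definable_dpred n (S : set 'rV[M]_n) : M ->
  definable I S -> dpred (fun e => S (\row_(i < n) e i)).
Proof.
move=> a [phi [q Sphi]].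
exists (renf (fun k => if (k < n)%N then k.*2 else (k - n).*2.+1) phi), q => e.
rewrite Sphi sat_renf; suff -> : assign (\row_(i < n) e i) q =
   interleave e q \o (fun k => if (k < n)%N then k.*2 else (k - n).*2.+1) by [].
apply/funext => k /=; rewrite /interleave; have [kn|nk] := ltnP k n.
  rewrite odd_double doubleK; have := assign_ord (\row_(i < n) e i) q (Ordinal kn).
  by rewrite mxE.
by rewrite -{1}(subnKC nk) assign_add /= odd_double /= uphalf_double.
Qed.

Lemma dterm_drop n t : dterm t -> dterm (fun e => t (fun k => e (n + k)%N)).
Proof.
move=> [u [q tE]].
exists (rent (fun k => if odd k then k else (n + k./2).*2) u), q => e.
rewrite tE eval_rent; congr (Defs.eval I _ u); apply/funext => k /=.
rewrite /interleave; case: ifP => kO; first by rewrite kO.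
by rewrite odd_double doubleK.
Qed.

(** Substitution of terms into a formula is avoided by quantifying over a row equal to the row of
    terms. *)
Lemma dpred_set n (S : set 'rV[M]_n) (y : (nat -> M) -> 'rV[M]_n) : M ->
  definable I S -> (forall i, dterm (fun e => y e ord0 i)) ->
  dpred (fun e => S (y e)).
Proof.
move=> a dS dy.
apply: (dpred_iff (Q := fun e =>
    exists z : 'rV[M]_n, (forall i, z ord0 i = y e ord0 i) /\ S z)) => [e|].
  split=> [Sy|[z [zy]]]; first by exists (y e).
  suff -> : z = y e by [].
  by apply/matrixP => i j; rewrite ord1.
apply: (@dpred_exrow n (fun (z : 'rV[M]_n) e =>
  (forall i, z ord0 i = y e ord0 i) /\ S z)) => //.
apply: dpred_and; last exact: definable_dpred.
apply: dpred_all_ord => // i; apply: dpred_eq.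
  by under eq_fun do rewrite mxE; exact: dterm_var.
exact: (dterm_drop n (dy i)).
Qed.

Lemma dpred_definable1 (S : set M) :
  dpred (fun e => S (e 0%N)) -> definable1 I S.
Proof.
by move=> dS; apply: dpred_definable; apply: dpred_iff dS => e; rewrite /= mxE.
Qed.

Lemma dterm_app2 (op : M -> M -> M) (f : term L -> term L -> term L) t u :
  (forall e v w, Defs.eval I e (f v w) = op (Defs.eval I e v) (Defs.eval I e w)) ->
  dterm t -> dterm u -> dterm (fun e => op (t e) (u e)).
Proof.
move=> fE [t' [q tE]] [u' [q' uE]].
exists (f (rent (widen false) t') (rent (widen true) u')), (interleave q q') => e.
by rewrite fE !eval_rent !widenE tE uE.
Qed.

Lemma dterm_app1 (op : M -> M) (f : term L -> term L) t :
  (forall e v, Defs.eval I e (f v) = op (Defs.eval I e v)) ->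
  dterm t -> dterm (fun e => op (t e)).
Proof. by move=> fE [t' [q tE]]; exists (f t'), q => e; rewrite fE tE. Qed.

End DefinablePredicates.

(** Only the existence of terms for the operations and of a formula for the predicate is retained,
    so that the same closure lemmas serve the expansion of K and the ring C(X) with its
    predicate. *)
Definition expands_ring (L : language) (R : pzRingType) (I : interp L R)
    (P : set R) : Prop :=
  exists (add mul : term L -> term L -> term L) (opp : term L -> term L)
    (mem : term L -> formula L),
  forall e, [/\ forall t u, Defs.eval I e (add t u) = Defs.eval I e t + Defs.eval I e u,
    forall t u, Defs.eval I e (mul t u) = Defs.eval I e t * Defs.eval I e u,
    forall t, Defs.eval I e (opp t) = - Defs.eval I e t &
    forall t, sat I e (mem t) <-> P (Defs.eval I e t)].
Existing Class expands_ring.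

#[export] Instance expands_ring_pred (R : pzRingType) (P : set R) :
  expands_ring (ring_pred_interp P) P.
Proof.
pose L := ring_pred_lang.
exists (fun t u => @App L RAdd (fun i => if val i == 0%N then t else u)).
exists (fun t u => @App L RMul (fun i => if val i == 0%N then t else u)).
exists (fun t => @App L ROpp (fun=> t)), (fun t => @FRel L tt (fun=> t)) => e.
by split=> // t; split.
Qed.

#[export] Instance expands_ring_full (F : ov_field) (E : expansion F) :
  expands_ring (full_interp E) (@unit_ball F).
Proof.
pose L := lang_sum ring_pred_lang (extra_lang E).
exists (fun t u => @App L (inl RAdd) (fun i => if val i == 0%N then t else u)).
exists (fun t u => @App L (inl RMul) (fun i => if val i == 0%N then t else u)).
exists (fun t => @App L (inl ROpp) (fun=> t)), (fun t => @FRel L (inl tt) (fun=> t)).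
by move=> e; split=> // t; split.
Qed.

Section RingDefinable.
Variables (L : language) (R : pzRingType) (I : interp L R) (P : set R).
Context {IP : expands_ring I P}.
Implicit Types t u : (nat -> R) -> R.

Lemma dterm_add t u : dterm I t -> dterm I u -> dterm I (fun e => t e + u e).
Proof.
have [f [f2 [f3 [f4 H]]]] := IP.
by apply: (@dterm_app2 _ _ _ +%R f) => e v w; have [] := H e.
Qed.

Lemma dterm_mul t u : dterm I t -> dterm I u -> dterm I (fun e => t e * u e).
Proof.
have [f2 [f [f3 [f4 H]]]] := IP.
by apply: (@dterm_app2 _ _ _ *%R f) => e v w; have [] := H e.
Qed.

Lemma dterm_opp t : dterm I t -> dterm I (fun e => - t e).
Proof.
have [f2 [f3 [f [f4 H]]]] := IP.
by apply: (@dterm_app1 _ _ _ -%R f) => e v; have [] := H e.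
Qed.

Lemma dpred_mem t : dterm I t -> dpred I (fun e => P (t e)).
Proof.
have [f2 [f3 [f4 [f H]]]] := IP.
move=> [u [q tE]]; exists (f u), q => e; rewrite tE.
by have [_ _ _ H4] := H (interleave e q); rewrite H4.
Qed.

Lemma dterm_ringvar k : dterm I (fun e => e k).
Proof. exact: (dterm_var _ _ 0). Qed.

End RingDefinable.

Ltac dterm_tac :=
  repeat first [ assumption | exact: dterm_ringvar
               | solve [apply: (dterm_drop 1); assumption] | exact: dterm_const
               | apply: dterm_add | apply: dterm_mul | apply: dterm_opp ].

Ltac dpred_step :=
  first [ apply: dpred_ex | apply: dpred_all | apply: dpred_and | apply: dpred_or
        | apply: dpred_not | apply: dpred_imp
        | solve [apply: dpred_eq; dterm_tac] | solve [apply: dpred_mem; dterm_tac] ].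
Ltac dpred_tac := repeat (dpred_step; cbv beta).

(** * Absolute values *)

Section AbsoluteValue.
Variable F : ov_field.
Implicit Types a b c r u z : carrier F.

Lemma unit_ball1 : unit_ball (1 : carrier F).
Proof.
case: F => [R|K v] /=; first by rewrite lexx (le_trans (lerN10 R) ler01).
by right; rewrite val_of1.
Qed.

Lemma unit_ballM a b : unit_ball a -> unit_ball b -> unit_ball (a * b).
Proof.
case: F a b => [R|K v] a b.
  move=> /unit_ball_ordered a1 /unit_ball_ordered b1; apply/unit_ball_ordered.
  by rewrite (normrM (a : R) b) mulr_ile1.
have [a0|a0] := eqVneq (a : K) 0; first by left; rewrite a0 mul0r.
have [b0|b0] := eqVneq (b : K) 0; first by left; rewrite b0 mulr0.
case=> [/eqP|av]; first by rewrite (negbTE a0).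
case=> [/eqP|bv]; first by rewrite (negbTE b0).
right; rewrite val_ofM//; apply: (le_trans av).
by rewrite value_leN addrC addKr.
Qed.

Lemma unit_ball_total a : unit_ball a \/ unit_ball a^-1.
Proof.
have [->|a0] := eqVneq a 0.
  left; case: (F) => [R|K v] /=; last by left.
  by rewrite lerN10 ler01.
case: F a a0 => [R|K v] a a0.
  have [a1|/ltW a1] := leP `|a : R| 1; first by left; exact/unit_ball_ordered.
  right; apply/unit_ball_ordered.
  by rewrite (normfV (a : R)) invf_le1// normr_gt0.
have [a1|/value_leNgt/ltW a1] := boolP (0 <= val_of v a); first by left; right.
by right; right; rewrite val_ofV//; move: a1; rewrite value_leN sub0r.
Qed.

Lemma vle_refl a : vle a a.
Proof. by exists 1; [exact: unit_ball1|rewrite mulr1]. Qed.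

Lemma vle_trans b a c : vle a b -> vle b c -> vle a c.
Proof.
move=> [o oO ->] [o' oO' ->]; exists (o' * o); first exact: unit_ballM.
by rewrite mulrA.
Qed.

Lemma vle_total a b : vle a b \/ vle b a.
Proof.
have [->|b0] := eqVneq b 0.
  right; exists 0; last by rewrite mulr0.
  have [//|] := unit_ball_total (0 : carrier F); by rewrite invr0.
have [->|a0] := eqVneq a 0.
  left; exists 0; last by rewrite mulr0.
  have [//|] := unit_ball_total (0 : carrier F); by rewrite invr0.
have [abO|baO] := unit_ball_total (a / b).
  by left; exists (a / b) => //; rewrite mulrC divfK.
by right; exists (a / b)^-1 => //; rewrite invf_div mulrC divfK.
Qed.

Lemma vle_vlt_trans b a c : vle a b -> vlt b c -> vlt a c.
Proof.
move=> ab [bc ncb]; split; first exact: vle_trans bc.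
by move=> ca; apply: ncb; exact: vle_trans ab.
Qed.

Lemma not_vle a b : ~ vle a b -> vlt b a.
Proof. by move=> nab; split=> //; case: (vle_total a b). Qed.

Lemma vle_mull c a b : vle a b -> vle (c * a) (c * b).
Proof. by move=> [o oO ->]; exists o; rewrite ?mulrA. Qed.

Lemma vle_pmull c a b : c != 0 -> vle (c * a) (c * b) <-> vle a b.
Proof.
move=> c0; split; last exact: vle_mull.
by move=> /(vle_mull c^-1); rewrite !mulKf.
Qed.

Lemma vlt_pmull c a b : c != 0 -> vlt (c * a) (c * b) <-> vlt a b.
Proof. by move=> c0; rewrite /vlt !vle_pmull. Qed.

Lemma vltN a r : vlt (- a) r <-> vlt a r.
Proof.
suff H b : vlt b r -> vlt (- b) r.
  by split=> /H //; rewrite opprK.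
apply: vle_vlt_trans; exists (- 1); last by rewrite mulrN1.
have [//|] := unit_ball_total (- 1 : carrier F).
by rewrite invrN1.
Qed.

End AbsoluteValue.

Lemma vlt_ultra (K : fieldType) (v : valuation K) (x y r : carrier (ValuedField v)) :
  vlt x r -> vlt y r -> vlt (x + y) r.
Proof.
move=> /vlt_valued[r0 xr] /vlt_valued[_ yr]; apply/vlt_valued; split=> //.
case: yr => [->|[y0 yr]].
  by have -> : x + (0 : carrier (ValuedField v)) = x by exact: addr0.
case: xr => [->|[x0 xr]].
  have -> : (0 : carrier (ValuedField v)) + y = y by exact: add0r.
  by right.
have [xy0|xy0] := eqVneq (x + y : K) 0; [by left|right; split=> //].
have := val_ofD v x0 y0 xy0; apply: lt_le_trans.
by rewrite /Order.min; case: ifP.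
Qed.

Section AbsoluteValueNear.
Variable F : ov_field.
Implicit Types a b c r u z : carrier F.

(** Elements near a non-zero [a] are bounded away from 0: t = a/2 works by the triangle inequality
    in the ordered case, and t = a by the ultrametric inequality in the valued case. *)
Lemma vlt_near a : a != 0 ->
  exists2 t, t != 0 & forall z u, vlt (z - a) t -> vlt u t -> vlt u z.
Proof.
case: F a => [R|K v] a a0.
  exists (a / 2%:R : R); first by rewrite mulf_neq0// invr_eq0 pnatr_eq0.
  move=> z u /vlt_ordered + /vlt_ordered + ; rewrite normf_div (ger0_norm (ler0n _ _)).
  move=> za ua; apply/vlt_ordered; apply: (lt_trans ua).
  have := ler_distD (z : R) a 0; rewrite !subr0 distrC => az.
  have {az} := le_lt_trans az (ltr_leD za (lexx `|z : R|)).
  by rewrite {1}[`|a : R|]splitr ltrD2l.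
exists a => // z u za ua; apply: not_vle => zu.
have := vlt_ultra (vle_vlt_trans zu ua) (proj2 (vltN _ _) za).
by rewrite opprB addrC subrK => -[aa]; exact.
Qed.

Lemma vlt_inv a r : a != 0 -> r != 0 ->
  exists2 s, s != 0 & forall z, vlt (z - a) s -> z != 0 /\ vlt (z^-1 - a^-1) r.
Proof.
move=> a0 r0; have [t t0 tz] := vlt_near a0.
have [s s0 st] := vlt_mulr (r * a)^-1 t0.
have [w w0 wP] := vlt_min t0 s0; exists w => // z /wP[zt zs].
have z0 : z != 0 by apply: vlt_neq0 (tz _ _ zt (vlt0 t0)).
(* The difference of the inverses is, up to sign, r/z times (z - a)/(ra), and the second factor is
   smaller than z. *)
split=> //; have := tz _ _ zt (st _ zs).
have ra0 : r / z != 0 by rewrite mulf_neq0// invr_eq0.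
rewrite -(vlt_pmull _ _ ra0) divfK// -vltN.
suff -> : - (r / z * ((r * a)^-1 * (z - a))) = z^-1 - a^-1 by [].
by field; rewrite a0 z0.
Qed.

End AbsoluteValueNear.

(** * Bounded and separated subsets of K *)

Section FiniteSets.
Variable F : ov_field.
Implicit Types (a b c r : carrier F) (s : seq (carrier F)).

Lemma seq_bounded s : exists r, forall a, a \in s -> vle a r.
Proof.
elim: s => [|b s [r rs]]; first by exists 0.
have [br|rb] := vle_total b r.
  by exists r => a; rewrite inE => /predU1P[->//|]; exact: rs.
exists b => a; rewrite inE => /predU1P[->|/rs ar]; first exact: vle_refl.
exact: vle_trans rb.
Qed.

Lemma seq_separated s a :
  exists2 r, r != 0 & forall b, b \in s -> vlt (b - a) r -> b = a.
Proof.
elim: s => [|c s [r r0 rs]]; first by exists 1; rewrite ?oner_eq0.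
have [ca|ca] := eqVneq c a.
  by exists r => // b; rewrite inE => /predU1P[->//|]; exact: rs.
have ca0 : c - a != 0 by rewrite subr_eq0.
have [t t0 tP] := vlt_min r0 ca0; exists t => // b; rewrite inE.
case/predU1P => [->|bs] /tP[]; last by move=> + _; exact: rs.
by move=> _ [+ nca]; move/nca.
Qed.

(* Quantifying over all [a], in [S] or not, makes [S] both discrete and closed. *)
Definition separated (S : set (carrier F)) : Prop :=
  forall a, exists2 r, r != 0 & forall b, S b -> vlt (b - a) r -> b = a.

Lemma separated_closed (S : set (carrier F)) : separated S -> closed S.
Proof.
move=> sep a Sa; have [r r0 rP] := sep a.
have [|b [Sb br]] := Sa [set b | vlt (b - a) r]; first by exists r.
by rewrite -(rP b).
Qed.

Lemma separated_isolated (S : set (carrier F)) : separated S -> isolated S = S.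
Proof.
move=> sep; apply/seteqP; split; first exact: isolatedS.
move=> a Sa; split; first exact: mem_set.
have [r r0 rP] := sep a; exists [set b | vlt (b - a) r]; first by exists r.
apply/seteqP; split=> [b [br Sb]|_ ->]; first exact: rP.
by split=> //=; rewrite subrr; exact: vlt0.
Qed.

End FiniteSets.

(** * Continuous definable functions *)

Section ContinuousDefinable.
Variables (F : ov_field) (E : expansion F) (m : nat) (X : defset E m).
Implicit Types (f g h k : contC X) (x y : X) (a b r : carrier F).

Local Notation K := (carrier F).
Local Notation I := (full_interp E).

Lemma nbhs_defset x (A : set X) :
  nbhs x A <-> exists2 r, r != 0 & forall y, oball (val x) r (val y) -> A y.
Proof.
rewrite nbhsE; split=> [[B [[C oC <-] xB] BA]|[r r0 rA]].
  have /nbhs_oball[r r0 rC] : nbhs (val x) C by exact: open_nbhs_nbhs.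
  by exists r => // y xy; apply: BA; exact: rC.
have xr : nbhs (val x) (oball (val x) r) by apply/nbhs_oball; exists r.
exists ((val : X -> 'rV[K]_m) @^-1` (oball (val x) r)°).
  by split; [exists (oball (val x) r)°; [exact: open_interior|]|].
by move=> y /interior_subset /rA.
Qed.

Lemma continuous_vlt (T : topologicalType) (k : T -> K) :
  continuous k <->
  forall (x : T) r, r != 0 -> nbhs x [set y : T | vlt (k y - k x) r].
Proof.
split=> [ck x r r0|kr x A [r r0 rA]]; last by apply: filterS (kr x r r0) => y /rA.
have nk : nbhs (k x) [set z | vlt (z - k x) r] by exists r.
exact: (ck x _ nk : nbhs x (k @^-1` _)).
Qed.

Lemma contC_continuous f : continuous f.
Proof. by case: f => f /= /asboolP[]. Qed.

Lemma contC0 x : (0 : contC X) x = 0. Proof. by []. Qed.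
Lemma contC1 x : (1 : contC X) x = 1. Proof. by []. Qed.
Lemma contCD f g x : (f + g) x = f x + g x. Proof. by []. Qed.
Lemma contCN f x : (- f) x = - f x. Proof. by []. Qed.
Lemma contCM f g x : (f * g) x = f x * g x. Proof. by []. Qed.
Definition contCE := (contC0, contC1, contCD, contCN, contCM).

Lemma contC_eq f g : (forall x, f x = g x) -> f = g.
Proof. by move=> fg; apply/val_inj/funext. Qed.

Lemma dpred_defset (y : (nat -> K) -> 'rV[K]_m) :
  (forall i, dterm I (fun e => y e ord0 i)) -> dpred I (fun e => defset_set X (y e)).
Proof. by apply: dpred_set; [exact: 0|exact: defsetP]. Qed.

Lemma dpred_graph f (y : (nat -> K) -> 'rV[K]_m) (t : (nat -> K) -> K) :
  (forall i, dterm I (fun e => y e ord0 i)) -> dterm I t ->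
  dpred I (fun e => exists2 x, val x = y e & f x = t e).
Proof.
move=> dy dt; case: f => f /= /asboolP[_ df].
apply: (dpred_iff (Q := fun e => [set p : 'rV[K]_(m + 1) | exists x : X,
   p = row_mx (val x) (const_mx (f x))] (row_mx (y e) (const_mx (t e))))).
  move=> e; split=> [[x <- <-]|]; first by exists x.
  move=> [x /eq_row_mx[yx /matrixP/(_ ord0 ord0)]]; rewrite !mxE => tx.
  by exists x.
apply: dpred_set => // [|i]; first exact: 0.
have [j ij|j ij] := split_ordP i.
  rewrite ij; under eq_fun do rewrite row_mxEl; exact: dy.
by rewrite ij; under eq_fun do rewrite row_mxEr mxE.
Qed.

Lemma contC_build (k : X -> K) : continuous k ->
  dpred I (fun e => exists2 x, val x = \row_(i < m) e i & k x = e m) ->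
  exists f, forall x, f x = k x.
Proof.
move=> ck dk; suff kP : k \in cont_def X by exists (ContC kP).
apply/asboolP; split=> //; apply: dpred_definable; apply: dpred_iff dk => e /=.
have -> : \row_(i < m + 1) e i = row_mx (\row_(i < m) e i) (const_mx (e m)).
  apply/matrixP => i j; rewrite mxE; have [l ->|l ->] := split_ordP j.
    by rewrite row_mxEl mxE.
  by rewrite row_mxEr mxE /= ord1 addn0.
split=> [[x /eq_row_mx[yx /matrixP/(_ ord0 ord0)]]|[x <- <-]]; last by exists x.
by rewrite !mxE => tx; exists x.
Qed.

Lemma contC_cst a : exists f, forall x, f x = a.
Proof.
apply: (contC_build (k := cst a)); first exact: cst_continuous.
apply: (dpred_iff (Q := fun e => defset_set X (\row_(i < m) e i) /\ e m = a)).
  move=> e; split=> [[x xe <-]|[Xe ea]].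
    by split=> //; rewrite -xe; exact: set_valP.
  by exists (SigSub (mem_set Xe)).
apply: dpred_and; last by dpred_tac.
by apply: dpred_defset => i; under eq_fun do rewrite mxE; dterm_tac.
Qed.

Lemma contC_coord (i : 'I_m) : exists f, forall x, f x = val x ord0 i.
Proof.
apply: (contC_build (k := fun x => val x ord0 i)).
  apply/continuous_vlt => x r r0; apply/nbhs_defset; exists r => // y; exact.
apply: (dpred_iff (Q := fun e => defset_set X (\row_(i < m) e i) /\ e m = e i)).
  move=> e; split=> [[x xe <-]|[Xe ea]].
    by split; [rewrite -xe; exact: set_valP|rewrite xe mxE].
  by exists (SigSub (mem_set Xe)) => //=; rewrite mxE.
apply: dpred_and; last by dpred_tac.
by apply: dpred_defset => j; under eq_fun do rewrite mxE; dterm_tac.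
Qed.

(** Continuity is asked of the composite and not of [phi], which may be discontinuous off the values
    taken, as inversion is at 0. *)
Lemma contC_comp f g (phi : K -> K -> K) :
  continuous (fun x => phi (f x) (g x)) ->
  (forall t u v, dterm I t -> dterm I u -> dterm I v ->
    dpred I (fun e => t e = phi (u e) (v e))) ->
  exists k, forall x, k x = phi (f x) (g x).
Proof.
move=> cphi dphi; apply: contC_build => //.
apply: (dpred_iff (Q := fun e => exists u v,
   (exists2 x, val x = \row_(i < m) e i & f x = u) /\
   (exists2 x, val x = \row_(i < m) e i & g x = v) /\ e m = phi u v)).
  move=> e; split=> [[x xe <-]|[u [v [[x xe <-] [[y ye <-] ->]]]]].
    by exists (f x), (g x); split; [|split=> //]; exists x.
  by exists x => //; suff -> : x = y by []; apply/val_inj; rewrite xe.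
apply: dpred_ex; apply: dpred_ex; cbv beta; apply: dpred_and; last apply: dpred_and.
- apply: dpred_graph; [move=> i; under eq_fun do rewrite mxE|]; dterm_tac.
- apply: dpred_graph; [move=> i; under eq_fun do rewrite mxE|]; dterm_tac.
- by apply: dphi; dterm_tac.
Qed.

End ContinuousDefinable.

Section DefinableOrder.
Variables (F : ov_field) (E : expansion F).
Implicit Types t u : (nat -> carrier F) -> carrier F.

Lemma dpred_vle t u : dterm (full_interp E) t -> dterm (full_interp E) u ->
  dpred (full_interp E) (fun e => vle (t e) (u e)).
Proof.
move=> dt du.
apply: (dpred_iff (Q := fun e => exists o, unit_ball o /\ t e = u e * o)).
  by move=> e; split=> [[o oO tE]|[o [oO tE]]]; exists o.
by dpred_tac.
Qed.

Lemma dpred_vlt t u : dterm (full_interp E) t -> dterm (full_interp E) u ->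
  dpred (full_interp E) (fun e => vlt (t e) (u e)).
Proof.
by move=> dt du; apply: dpred_and; [|apply: dpred_not]; exact: dpred_vle.
Qed.

End DefinableOrder.

(** * Units, norms and unit ideals in C(X) *)

Section Inverse.
Variables (F : ov_field) (E : expansion F) (m : nat) (X : defset E m).

Lemma contC_inv (g : contC X) : (forall x, g x != 0) -> exists u, u * g = 1.
Proof.
move=> g0; have [||u ug] := contC_comp (f := g) (g := g) (phi := fun a _ => a^-1).
- apply/continuous_vlt => x r r0; have [s s0 sP] := vlt_inv (g0 x) r0.
  have /continuous_vlt/(_ x s s0) := contC_continuous (f := g).
  by apply: filterS => y /sP[].
- move=> t u v dt du dv.
  (* The second disjunct is the convention that the inverse of 0 is 0. *)
  apply: (dpred_iff (Q := fun e => t e * u e = 1 \/ u e = 0 /\ t e = 0)); last first.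
    by dpred_tac.
  move=> e; split=> [->|[tu|[-> ->]]]; last by rewrite invr0.
    have [->|u0] := eqVneq (u e) 0; first by right; rewrite invr0.
    by left; rewrite mulVf.
  have u0 : u e != 0.
    by apply/eqP => u0; move/eqP: tu; rewrite u0 mulr0 eq_sym oner_eq0.
  by rewrite -[RHS]mul1r -tu mulfK.
by exists u; apply: contC_eq => x; rewrite !contCE ug mulVf.
Qed.

End Inverse.

Section Ultrametric.
Variables (K0 : fieldType) (v : valuation K0).
Local Notation K := (carrier (ValuedField v)).
Implicit Types a b r x y : K.

Lemma vle_ultra x y r : vle x r -> vle y r -> vle (x + y) r.
Proof.
move=> xr yr; apply: contrapT => /not_vle rxy.
by have [xy []] := vlt_ultra (vle_vlt_trans xr rxy) (vle_vlt_trans yr rxy).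
Qed.

Lemma vle_ultra_near a x : vlt (x - a) a -> vle x a /\ vle a x.
Proof.
move=> xa; split.
  by rewrite -(subrK a x); apply: vle_ultra; [case: xa|exact: vle_refl].
apply: contrapT => /not_vle xa'.
have := vlt_ultra xa' (proj2 (vltN _ _) xa).
by rewrite opprB addrC subrK => -[aa]; exact.
Qed.

(** An element close enough to a non-zero one has the same absolute value. Hence, for a valuation,
    functions chosen by comparing |g| and |h| are continuous away from the common zeros. *)
Lemma vle_locally_constant (T : topologicalType) (g h : T -> K) (x : T) :
  continuous g -> continuous h -> g x != 0 \/ h x != 0 ->
  nbhs x [set y | vle (h y) (g y) <-> vle (h x) (g x)].
Proof.
move=> /continuous_vlt cg /continuous_vlt ch gh0.
have [hg|gh] := pselect (vle (h x) (g x)).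
  have gx0 : g x != 0.
    case: gh0 hg => // hx0 [o _ hE]; apply: contra_neq hx0.
    by rewrite hE => ->; rewrite mul0r.
  apply: (filterS2 _ _ (cg x _ gx0) (ch x _ gx0)) => y /vle_ultra_near[_ gg] hh.
  split=> // _; apply: vle_trans gg; rewrite -(subrK (h x) (h y)).
  by apply: vle_ultra => //; case: hh.
have hx0 : h x != 0 by exact: vlt_neq0 (not_vle gh).
apply: (filterS2 _ _ (cg x _ hx0) (ch x _ hx0)) => y gg /vle_ultra_near[_ hh].
split=> // hg; have [_ []] : vlt (g y) (h x).
  by rewrite -(subrK (g x) (g y)); apply: vlt_ultra => //; exact: not_vle.
exact: vle_trans hh hg.
Qed.

End Ultrametric.

Section Norm.

Lemma contC_sumsq (R : realFieldType) (E : expansion (OrderedField R)) m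
    (X : defset E m) (g h : contC X) r : r != 0 ->
  exists2 s, s != 0 & forall x, vlt ((g * g + h * h) x) s -> vlt (g x) r /\ vlt (h x) r.
Proof.
move=> r0; exists (r * r); first by rewrite mulf_neq0.
have sq (a b : R) : a * a + b * b < r * r -> `|a| < `|r|.
  move=> ab; rewrite -(ltr_pXn2r (n := 2)) ?nnegrE//.
  rewrite -!normrX !ger0_norm ?sqr_ge0// !expr2; apply: le_lt_trans ab.
  by rewrite lerDl -expr2 sqr_ge0.
move=> x /vlt_ordered; rewrite !contCE => gh; split; apply/vlt_ordered.
  apply: (sq _ (h x)); move: gh.
  by rewrite ger0_norm ?addr_ge0// -?expr2 ?sqr_ge0// ger0_norm// ?sqr_ge0.
apply: (sq _ (g x)); rewrite addrC; move: gh.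
by rewrite ger0_norm ?addr_ge0// -?expr2 ?sqr_ge0// ger0_norm// ?sqr_ge0.
Qed.

Lemma contC_max (K0 : fieldType) (v : valuation K0) (E : expansion (ValuedField v)) m
    (X : defset E m) (g h : contC X) :
  exists k : contC X, forall x, k x = if `[< vle (h x) (g x) >] then g x else h x.
Proof.
apply: (contC_comp (f := g) (g := h)
  (phi := fun u w => if `[< vle w u >] then u else w)); last first.
  move=> t u w dt du dw.
  apply: (dpred_iff (Q := fun e =>
    vle (w e) (u e) /\ t e = u e \/ ~ vle (w e) (u e) /\ t e = w e)).
    by move=> e; case: asboolP => wu; split=> [->|[] []//]; [left|right].
  have ? := dpred_vle dw du.
  by apply: dpred_or; apply: dpred_and; do ?[apply: dpred_not|assumption]; dpred_tac.
have /continuous_vlt cg := contC_continuous (f := g).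
have /continuous_vlt ch := contC_continuous (f := h).
apply/continuous_vlt => x r r0; have [gh0|] := pselect (g x != 0 \/ h x != 0).
  have := vle_locally_constant (contC_continuous (f := g))
    (contC_continuous (f := h)) gh0.
  apply: (filterS3 _ _ (cg x r r0) (ch x r r0)) => y gy hy /= /asbool_equiv_eq ->.
  by case: asboolP.
move=> /not_orP[/negP/negPn/eqP gx0 /negP/negPn/eqP hx0].
apply: (filterS2 _ _ (cg x r r0) (ch x r r0)) => y.
by rewrite gx0 hx0 /= if_same; case: asboolP.
Qed.

(** One function measures the size of a pair: the sum of squares in the ordered case, and in the
    valued case, where squares could cancel, whichever of the two is larger. It merges several
    smallness conditions into one. *)
Lemma contC_norm (F : ov_field) (E : expansion F) m (X : defset E m) (g h : contC X) :
  exists2 k : contC X, (forall x, g x = 0 -> h x = 0 -> k x = 0) &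
    forall r, r != 0 -> exists2 s, s != 0 &
      forall x, vlt (k x) s -> vlt (g x) r /\ vlt (h x) r.
Proof.
case: F E X g h => [R|K0 v] E X g h.
  exists (g * g + h * h); last by move=> r; exact: contC_sumsq.
  by move=> x gx hx; rewrite !contCE gx hx mulr0 addr0.
have [k kE] := contC_max g h; exists k => [x gx hx|r r0].
  by rewrite kE gx hx if_same.
exists r => // x; rewrite kE; case: asboolP => [hg gr|/not_vle gh hr].
  by split=> //; exact: vle_vlt_trans gr.
by split=> //; apply: vle_vlt_trans hr; case: gh.
Qed.

Lemma contC_choose (K0 : fieldType) (v : valuation K0) (E : expansion (ValuedField v)) m
    (X : defset E m) (g h : contC X) : (forall x, g x != 0 \/ h x != 0) ->
  exists k : contC X, forall x, k x = if `[< vle (h x) (g x) >] then 1 else 0.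
Proof.
move=> gh0; apply: (contC_comp (f := g) (g := h)
  (phi := fun u w => if `[< vle w u >] then 1 else 0)); last first.
  move=> t u w dt du dw.
  apply: (dpred_iff (Q := fun e =>
    vle (w e) (u e) /\ t e = 1 \/ ~ vle (w e) (u e) /\ t e = 0)).
    by move=> e; case: asboolP => wu; split=> [->|[] []//]; [left|right].
  have ? := dpred_vle dw du.
  by apply: dpred_or; apply: dpred_and; do ?[apply: dpred_not|assumption]; dpred_tac.
apply/continuous_vlt => x r r0.
have := vle_locally_constant (contC_continuous (f := g))
  (contC_continuous (f := h)) (gh0 x).
by apply: filterS => y /= /asbool_equiv_eq ->; rewrite subrr; exact: vlt0.
Qed.

(** A nowhere vanishing combination of g and h is a unit. In the ordered case it is the sum of
    squares; in the valued case it is c g + (1 - c) h, where the idempotent [c] selects at each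
    point the one of larger absolute value. *)
Lemma contC_bezout (F : ov_field) (E : expansion F) m (X : defset E m) (g h : contC X) :
  (forall x, g x != 0 \/ h x != 0) -> exists u v, u * g + v * h = 1.
Proof.
case: F E X g h => [R|K0 v] E X g h gh0.
  have [x|u uE] := contC_inv (g := g * g + h * h); last first.
    by exists (u * g), (u * h); rewrite -!mulrA -mulrDr.
  have sq (a b : R) : a != 0 \/ b != 0 -> a * a + b * b != 0.
    rewrite -!expr2 => ab; rewrite paddr_eq0 ?sqr_ge0// !sqrf_eq0.
    by case: ab => /negbTE ->; rewrite ?andbF.
  exact: sq (gh0 x).
have [c cE] := contC_choose gh0.
have [x|u uE] := contC_inv (g := c * g + (1 - c) * h); last first.
  by exists (u * c), (u * (1 - c)); rewrite -!mulrA -mulrDr.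
rewrite !contCE cE; case: asboolP => [hg|/not_vle/vlt_neq0 hx].
  rewrite mul1r subrr mul0r addr0.
  case: (gh0 x) => // hx0; apply: contra_neq hx0 => gx.
  by case: hg => o _; rewrite gx mul0r.
by rewrite mul0r subr0 add0r mul1r.
Qed.

End Norm.

(** * Points coded by functions *)

Section Points.
Variables (F : ov_field) (E : expansion F) (m : nat) (X : defset E m).
Implicit Types (f g h k p q s c w : contC X) (x y : X) (a b r : carrier F).

(** The function plays the role of the distance to x, so that closeness to x becomes an inequality
    between values of elements of C(X). *)
Lemma contC_dist x : exists2 k : contC X, k x = 0 &
  forall r, r != 0 -> exists2 t, t != 0 &
    forall y, vlt (k y) t -> oball (val x) r (val y).
Proof.
suff [k kx kP] : exists2 k : contC X, k x = 0 &
    forall r, r != 0 -> exists2 t, t != 0 &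
      forall y, vlt (k y) t -> forall i, i \in enum 'I_m ->
        vlt (val y ord0 i - val x ord0 i) r.
  exists k => // r /kP[t t0 tP]; exists t => // y /tP yP i.
  by apply: yP; rewrite mem_enum.
elim: (enum 'I_m) => [|i l [k kx kP]].
  by exists 0 => // r r0; exists 1 => //; exact: oner_neq0.
have [g gE] := contC_coord X i; have [d dE] := contC_cst X (val x ord0 i).
have [n n0 nP] := contC_norm (g - d) k; exists n.
  by apply: n0; rewrite ?kx // !contCE gE dE subrr.
move=> r r0; have [t t0 tP] := kP r r0.
have [u u0 uP] := vlt_min r0 t0; have [w w0 wP] := nP u u0.
exists w => // y /wP[/uP[+ _] /uP[_ /tP yP]] j; rewrite !contCE gE dE => yi.
by rewrite inE => /predU1P[->//|]; exact: yP.
Qed.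

Definition codes p x : Prop := forall y, p y = 0 <-> y = x.

Lemma codes_exist x : exists p, codes p x.
Proof.
have [k kx kP] := contC_dist x; exists k => y; split=> [ky|->//].
(* Were a coordinate difference r non-zero, y would lie in the ball of radius r about x, and so |r|
   < |r|. *)
apply/val_inj/matrixP => i j; rewrite ord1; apply/eqP; rewrite -subr_eq0.
apply/negPn/negP => r0; have [t t0 /(_ y)] := kP _ r0.
by rewrite ky => /(_ (vlt0 t0) j)[].
Qed.

Definition common_zero g h : Prop := ~ exists u v, u * g + v * h = 1.

Lemma common_zeroP g h : common_zero g h <-> exists2 x, g x = 0 & h x = 0.
Proof.
split=> [gh|[x gx hx] [u [v /(congr1 (fun k => contC_fun k x))]]].
  apply: contrapT => ngh; apply: gh; apply: contC_bezout => x.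
  apply/orP; rewrite -negb_and; apply/negP => /andP[/eqP gx /eqP hx].
  by apply: ngh; exists x.
by move/eqP; rewrite !contCE gx hx !mulr0 addr0 eq_sym oner_eq0.
Qed.

Lemma codes_zero p x g : codes p x -> common_zero p g <-> g x = 0.
Proof.
move=> px; rewrite common_zeroP; split=> [[y /px ->]//|gx].
by exists x => //; exact/px.
Qed.

(** The first clause gives a zero. The second excludes two distinct zeros: functions vanishing at
    exactly one of them each would meet the zeros of p without having a common zero. *)
Definition point_code p : Prop :=
  common_zero p p /\
  forall g h, common_zero p g -> common_zero p h -> common_zero g h.

Lemma point_codeP p : point_code p <-> exists x, codes p x.
Proof.
split=> [[/common_zeroP[x px _] pP]|[x px]].
  exists x => y; split=> [py|->//].
  have [k kx] := codes_exist x; have [l ly] := codes_exist y.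
  have /common_zeroP[z /kx zx /ly zy] : common_zero k l.
    apply: pP; apply/common_zeroP; first by exists x => //; exact/kx.
    by exists y => //; exact/ly.
  by rewrite -zx.
split; first by apply/common_zeroP; exists x; exact/px.
by move=> g h /(codes_zero _ px) gx /(codes_zero _ px) hx; apply/common_zeroP; exists x.
Qed.

Definition vle_at p g h : Prop :=
  exists c, contC_into X (@unit_ball F) c /\ common_zero p (g - h * c).

Lemma codes_vle p x g h : codes p x -> vle_at p g h <-> vle (g x) (h x).
Proof.
move=> px; split=> [[c [cO /(codes_zero _ px)]]|[o oO gx]].
  rewrite !contCE => /eqP; rewrite subr_eq0 => /eqP gx.
  by exists (c x) => //; apply: cO; exists x.
have [c cE] := contC_cst X o; exists c; split; first by move=> _ [y _ <-]; rewrite cE.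
by apply/(codes_zero _ px); rewrite !contCE gx cE subrr.
Qed.

Definition vlt_at p g h : Prop := vle_at p g h /\ ~ vle_at p h g.

Lemma codes_vlt p x g h : codes p x -> vlt_at p g h <-> vlt (g x) (h x).
Proof. by move=> px; rewrite /vlt_at !(codes_vle _ _ px). Qed.

(* The set of limits at [x] of the quotient [g / h] along the zeros of [s]
   outside those of [h]. *)
Definition slopes s g h x (a : carrier F) : Prop :=
  forall r, r != 0 -> exists y, oball (val x) r (val y) /\ s y = 0 /\
    exists a', h y != 0 /\ g y = h y * a' /\ vlt (a' - a) r.

(** The pair [w], [e] describes a neighbourhood of the coded point, the set where |w| < |e|, and [e]
    is also the tolerance on the slope. Radii in X and in K are thus quantified inside C(X). *)
Definition slope_at s g h p c : Prop :=
  forall w e, common_zero p w -> ~ common_zero p e ->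
  exists q, point_code q /\ vlt_at q w e /\ common_zero q s /\
    exists c', ~ common_zero q h /\ common_zero q (g - h * c') /\
      vlt_at q (c' - c) e.

Lemma codes_slope p x s g h c :
  codes p x -> slope_at s g h p c <-> slopes s g h x (c x).
Proof.
move=> px; split=> [sc r r0|sc w e /(codes_zero _ px) wx].
  have [k kx kP] := contC_dist x; have [l lE] := contC_cst X (c x).
  (* Smallness of [n] at a point forces the point to be near x and the value of c there to be near
     c(x). The constant [e] chosen below bounds both [n] and the error on the slope. *)
  have [n n0 nP] := contC_norm k (c - l).
  have [t t0 tP] := vlt_add r0; have [t1 t10 t1P] := kP r r0.
  have [t2 t20 t2P] := vlt_min t10 t0; have [t3 t30 t3P] := nP t2 t20.
  have [t4 t40 t4P] := vlt_min t30 t0; have [e eE] := contC_cst X t4.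
  have nx : n x = 0 by apply: n0 => //; rewrite !contCE lE subrr.
  have [||q [/point_codeP[y qy] H]] := sc n e.
  - exact/(codes_zero _ px).
  - by move=> /(codes_zero _ px); rewrite eE => /eqP; rewrite (negbTE t40).
  move: H; rewrite (codes_vlt _ _ qy) (codes_zero _ qy) eE => -[/t4P[/t3P[]]].
  move=> /t2P[/t1P xy _] /t2P[_ cy] _ [sy [c' []]].
  rewrite !(codes_zero _ qy) (codes_vlt _ _ qy) eE !contCE => hy [gy /t4P[_ c'y]].
  exists y; split=> //; split=> //; exists (c' y).
  split; [exact/eqP | split; first by apply/eqP; rewrite -subr_eq0 gy].
  by have := tP _ _ c'y cy; rewrite !contCE lE addrA subrK.
(* Conversely, as e(x) is non-zero, |e| exceeds every value below a threshold t near x, while w is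
   below t there and c is close to c(x). The radius r ensures all three. *)
rewrite (codes_zero _ px) => /eqP ex.
have [t t0 tP] := vlt_near ex; have [t1 t10 t1P] := vlt_add t0.
have /continuous_vlt/(_ x t t0)/nbhs_defset[r1 r10 r1P] := contC_continuous (f := w).
have /continuous_vlt/(_ x t t0)/nbhs_defset[r2 r20 r2P] := contC_continuous (f := e).
have /continuous_vlt/(_ x t1 t10)/nbhs_defset[r3 r30 r3P] := contC_continuous (f := c).
have [r4 r40 r4P] := vlt_min r10 r20; have [r5 r50 r5P] := vlt_min r30 t10.
have [r r0 rP] := vlt_min r40 r50.
have [y [xy [sy [a [hy [gy ya]]]]]] := sc r r0.
have [q qy] := codes_exist y; have [d dE] := contC_cst X a.
have xy1 : vlt (w y - w x) t by apply: r1P => i; have /rP[/r4P[]] := xy i.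
have xy2 : vlt (e y - e x) t by apply: r2P => i; have /rP[/r4P[]] := xy i.
have xy3 : vlt (c y - c x) t1 by apply: r3P => i; have /rP[_ /r5P[]] := xy i.
exists q; split; first by apply/point_codeP; exists y.
rewrite wx subr0 in xy1; split; first by apply/(codes_vlt _ _ qy); exact: tP xy2 xy1.
split; first exact/(codes_zero _ qy).
exists d; rewrite !(codes_zero _ qy) (codes_vlt _ _ qy) !contCE dE.
split; [exact/eqP|split; first by rewrite gy subrr].
apply: tP xy2 _; have /rP[_ /r5P[_ ya1]] := ya.
have := t1P _ _ ya1 (proj2 (vltN _ _) xy3).
by rewrite opprB addrA subrK.
Qed.

End Points.

(** * Finite sets of slopes *)

Section Slopes.
Variables (F : ov_field) (E : expansion F) (m : nat) (X : defset E m).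
Implicit Types (f g h k p q s c w : contC X) (x y : X) (a b r : carrier F).

Lemma slopes_definable s g h x : definable1 (full_interp E) (slopes s g h x).
Proof.
apply: dpred_definable1.
(* A point of X is quantified as a row [z], and the values of s, g and h there as elements tied to
   [z] by the graphs, which also place [z] in X. *)
apply: (dpred_iff (Q := fun e => forall r, r <> 0 ->
   exists z : 'rV[carrier F]_m, exists u v t,
    (exists2 y : X, val y = z & s y = u) /\ (exists2 y : X, val y = z & g y = v) /\
    (exists2 y : X, val y = z & h y = t) /\
    (forall i, vlt (z ord0 i - val x ord0 i) r) /\ u = 0 /\
    exists a', t <> 0 /\ v = t * a' /\ vlt (a' - e 0%N) r)).
  move=> e; split=> [sl r /eqP/sl[y [xy [sy [a' [/eqP hy H]]]]]|sl r /eqP/sl].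
    exists (val y), (s y), (g y), (h y).
    by do !(split; first by exists y); split=> //; split=> //; exists a'.
  move=> [_ [u [v [t [[y <- <-] [[y1 /val_inj -> <-] [[y2 /val_inj -> <-] H]]]]]]].
  case: H => xy [sy [a' [/eqP hy H]]].
  by exists y; split=> //; split=> //; exists a'.
have coord n i : dterm (full_interp E)
    (fun e => (\row_(j < m) e (n + j)%N) ord0 i).
  by under eq_fun do rewrite mxE; dterm_tac.
apply: dpred_all; cbv beta; apply: dpred_imp; first by dpred_tac.
apply: dpred_exrow; first exact: 0.
do 3 (apply: dpred_ex; cbv beta).
do 3 (apply: dpred_and; first by apply: dpred_graph; [exact: (coord 3)|dterm_tac]).
apply: dpred_and.
  apply: dpred_all_ord => [|i]; first exact: 0.
  apply: dpred_vlt; last by dterm_tac.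
  by apply: dterm_add; [exact: (coord 3)|exact: dterm_const].
apply: dpred_and; first by dpred_tac.
apply: dpred_ex; cbv beta; apply: dpred_and; first by dpred_tac.
by apply: dpred_and; [dpred_tac|apply: dpred_vlt; dterm_tac].
Qed.

(* [f] takes at the point [p] a value in the orbit of [c] under
   [z |-> a * z + b]: the set of slopes is finite, and closed under this map
   except at that value. *)
Definition reaches (a b c : contC X) p f : Prop :=
  exists s g h,
    (exists d, forall k, slope_at s g h p k -> vle_at p k d) /\
    (forall k, exists d, ~ common_zero p d /\
      forall l, slope_at s g h p l -> vlt_at p (l - k) d -> common_zero p (l - k)) /\
    slope_at s g h p c /\
    forall k, slope_at s g h p k ->
      common_zero p (k - f) \/ slope_at s g h p (a * k + b).

(** Every element of K is the value at x of a constant function, so quantifiers over C(X) read at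
    the coded point are quantifiers over K. *)
Lemma reachesP (a b c f : contC X) p x : codes p x ->
  reaches a b c p f <->
  exists s g h, let S := slopes s g h x in
    [/\ ov_bounded S, separated S, S (c x) &
        forall z, S z -> z = f x \/ S (a x * z + b x)].
Proof.
move=> px; pose slP s g h k := codes_slope s g h k px.
have zP k := codes_zero k px; have ltP' k l := codes_vlt k l px.
have leP' k l := codes_vle k l px.
split=> -[s [g [h H]]]; exists s, g, h.
  case: H => [[d dP] [sep [/slP Sc step]]]; split=> //.
  - exists (d x) => z Sz; have [k kE] := contC_cst X z.
    by rewrite -(kE x); apply/leP'/dP/slP; rewrite kE.
  - move=> z; have [k kE] := contC_cst X z; have [e [/zP/eqP ex eP]] := sep k.
    exists (e x) => // z' Sz' zz'; have [l lE] := contC_cst X z'.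
    have /zP : common_zero p (l - k).
      by apply: eP; [apply/slP; rewrite lE|apply/ltP'; rewrite !contCE lE kE].
    by rewrite !contCE lE kE => /eqP; rewrite subr_eq0 => /eqP.
  - move=> z Sz; have [k kE] := contC_cst X z.
    have /step[/zP|/slP] : slope_at s g h p k by apply/slP; rewrite kE.
      by rewrite !contCE kE => /eqP; rewrite subr_eq0 => /eqP; left.
    by rewrite !contCE kE; right.
case: H => [[d dP] sep Sc step]; split; [|split; [|split]].
- have [k kE] := contC_cst X d; exists k => l /slP /dP; rewrite -(kE x).
  by move/leP'.
- move=> k; have [r r0 rP] := sep (k x); have [d' dE] := contC_cst X r.
  exists d'; split; first by move=> /zP; rewrite dE => /eqP; rewrite (negbTE r0).
  move=> l /slP Sl /ltP'; rewrite !contCE dE => lk; apply/zP; rewrite !contCE.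
  by rewrite (rP _ Sl lk) subrr.
- exact/slP.
- move=> k /slP /step[kf|]; first by left; apply/zP; rewrite !contCE kf subrr.
  by move=> H; right; apply/slP; rewrite !contCE.
Qed.

End Slopes.

(** If the orbit of c avoided v, it would never leave S, and by injectivity it is infinite. *)
Lemma iter_mem_finite (T : eqType) (S : set T) (step : T -> T) (c v : T) :
  finite_set S -> injective (fun n => iter n step c) ->
  S c -> (forall z, S z -> z = v \/ S (step z)) -> exists n, v = iter n step c.
Proof.
move=> finS inj Sc stepS; apply: contrapT => nv.
have Sn n : S (iter n step c).
  by elim: n => //= n /stepS[vE|//]; case: nv; exists n.
apply: infinite_nat; apply: sub_finite_set (finite_preimage _ finS).
  by move=> n _; exact: Sn n.
by move=> i j _ _; exact: inj.
Qed.

(** * Orbits read off from finite sets of slopes *)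

Section Realization.
Variables (F : ov_field) (E : expansion F) (m : nat) (X : defset E m).
Implicit Types (f g h k p q s c w u v : contC X) (x y : X) (a b r : carrier F).

Lemma reaches_sound (a b c f : contC X) p x :
  (forall S : set (carrier F), definable1 (full_interp E) S ->
      closed S -> ov_bounded S -> isolated S = S -> finite_set S) ->
  injective (fun n => iter n (fun z => a x * z + b x) (c x)) ->
  codes p x -> reaches a b c p f ->
  exists n, f x = iter n (fun z => a x * z + b x) (c x).
Proof.
move=> hFin inj px /(reachesP _ _ _ _ px)[s [g [h [bS sep Sc stepS]]]].
apply: iter_mem_finite inj Sc stepS; apply: hFin => //.
- exact: slopes_definable.
- exact: separated_closed.
- exact: separated_isolated.
Qed.

(** This is what two independent local coordinates are used for: for every slope a, points of the
    line v = a u with u non-zero occur arbitrarily near x. *)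
Definition planar x : Prop := exists u v, forall a r, r != 0 ->
  exists y, oball (val x) r (val y) /\ u y != 0 /\ v y = u y * a.

Lemma slopes_planar x (A : seq (carrier F)) : planar x ->
  exists s g h, slopes s g h x = [set a | a \in A].
Proof.
move=> [u [v uv]].
have [s sE] : exists s, forall y, s y = \prod_(a <- A) (v y - u y * a).
  elim: A => [|a A [s sE]]; first by exists 1 => y; rewrite big_nil.
  have [k kE] := contC_cst X a; exists ((v - u * k) * s) => y.
  by rewrite !contCE big_cons sE kE.
exists s, v, u; apply/seteqP; split=> [a sl|a /= aA r r0]; last first.
  have [y [xy [uy vy]]] := uv a r r0; exists y; split=> //; split.
    rewrite sE; apply/eqP; rewrite prodf_seq_eq0; apply/hasP; exists a => //=.
    by rewrite vy subrr.
  by exists a; rewrite subrr; do !split=> //; case: (vlt0 r0).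
(* At a zero of s where u is non-zero, the quotient v/u is exactly an element of A, and an element
   of A close enough to a is a itself. *)
have [r r0 rP] := seq_separated A a.
have [y [_ [/eqP + [b [uy [vy ba]]]]]] := sl r r0.
rewrite sE prodf_seq_eq0 => /hasP[b' b'A /=].
rewrite vy -mulrBr mulf_eq0 (negbTE uy) /= subr_eq0 => /eqP bb'.
by rewrite -(rP b) // bb'.
Qed.

Lemma reaches_complete (a b c f : contC X) p x n : planar x -> codes p x ->
  f x = iter n (fun z => a x * z + b x) (c x) -> reaches a b c p f.
Proof.
set step := (fun z => _) => plx px fE; apply/(reachesP _ _ _ _ px).
(* The n + 1 listed points run from c(x) to the n-th iterate f(x), the only one whose image may fall
   outside the list. *)
have [s [g [h slE]]] := slopes_planar (traject step (c x) n.+1) plx.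
exists s, g, h; rewrite slE; split.
- have [r rP] := seq_bounded (traject step (c x) n.+1).
  by exists r => z /= /rP.
- by move=> z; have [r r0 rP] := seq_separated (traject step (c x) n.+1) z; exists r.
- by rewrite /= inE eqxx.
- move=> z /trajectP[i]; rewrite ltnS leq_eqVlt => /predU1P[->|iN] ->; first by left.
  by right; apply/trajectP; exists i.+1.
Qed.

(** By purity each ball centred in X cuts out of X a set of some dimension n at least d, hence at
    least 2. (Dim3) then gives a point there with a chart made of n coordinates, two of which serve
    as u and v. The hypothesis [small] says that the topology of K is not discrete. *)
Lemma planar_dense d : satisfies_Dim E ->
  (forall r : carrier F, r != 0 -> exists2 e, e != 0 & vlt e r) ->
  (2 <= d)%N -> pure_dim X d ->
  forall x r, r != 0 -> exists y, oball (val x) r (val y) /\ planar y.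
Proof.
move=> hDim small d2 hX x r r0.
have dY : definable (full_interp E) (oball (val x) r `&` X).
  apply: dpred_definable; apply: dpred_and; last first.
    by apply: dpred_defset => i; under eq_fun do rewrite mxE; dterm_tac.
  apply: dpred_all_ord => [|i]; first exact: 0.
  by apply: dpred_vlt; under eq_fun do rewrite ?mxE; dterm_tac.
pose Y := DefSet dY; have [_ /(_ r r0)] := hX _ (set_valP x).
rewrite -[_ `&` _]/(defset_set Y) => dimY.
have [n [nE n2]] : exists n : nat, Defs.dim Y = (n%:Z)%:E /\ (2 <= n)%N.
  move: dimY; rewrite /Defs.dim; case: asboolP => // _; set n := (\max_(J | _) _)%N.
  by rewrite lee_fin lez_nat => dn; exists n; split=> //; exact: leq_trans dn.
have [_ _ _ /(_ n nE)] := hDim m Y.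
(* Removing an empty [W_ n Y] would leave Y, whose dimension would then be less than itself. *)
have [[w Ww] _|nW] := pselect (W_ n Y !=set0); last first.
  have -> : Y `\` W_ n Y = Y.
    by apply/seteqP; split=> [z []|z Yz]//; split=> // Wz; apply: nW; exists z.
  by rewrite nE ltxx.
case: Ww => -[xw Xw] [rho [J [U [rho0 Jn oU [bij [_ [G [GK cG]]]]]]]].
pose y : X := SigSub (mem_set Xw); exists y; split=> //.
have J2 : (2 <= #|J|)%N by rewrite Jn.
pose i0 : 'I_#|J| := Ordinal (ltnW J2); pose i1 : 'I_#|J| := Ordinal J2.
have [u0 u0E] := contC_coord X (enum_val i0).
have [v0 v0E] := contC_coord X (enum_val i1).
have [ku kuE] := contC_cst X (w ord0 (enum_val i0)).
have [kv kvE] := contC_cst X (w ord0 (enum_val i1)).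
(* Two of the chart coordinates, translated so as to vanish at w. *)
exists (u0 - ku), (v0 - kv) => a t t0.
pose A := oball w rho `&` Y; have Aw : A w.
  by split; [move=> i; rewrite subrr; exact: vlt0|].
pose q0 := coord_proj J w.
have Uq0 : U q0 by case: bij => funA _ _; exact: funA.
have cGq0 : {for q0, continuous G}.
  by move: cG; rewrite continuous_open_subspace// => /(_ q0 (mem_set Uq0)).
have GqA : nbhs (G q0) (oball w t).
  by rewrite GK ?inE//; apply/nbhs_oball; exists t.
have /nbhs_oball[e e0 eP] : nbhs q0 (U `&` (G @^-1` oball w t)).
  by apply: filterI; [exact: open_nbhs_nbhs|exact: cGq0].
have [e1 e10 e1P] := vlt_mulr a e0; have [e2 e20 e2P] := vlt_min e0 e10.
have [z z0 ze2] := small e2 e20; have [ze /e1P zae] := e2P _ ze2.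
(* In the chart, w is moved by (z, a z) along the two chosen coordinates and not along the others.
   As z is non-zero and small, the inverse [G] of the chart yields a point within t of w on the line
   of slope a. *)
pose q : 'rV[carrier F]_#|J| :=
  \row_j (q0 ord0 j + (if j == i0 then z else if j == i1 then a * z else 0)).
have [Uq Gq] : (U `&` (G @^-1` oball w t)) q.
  apply: eP => j; rewrite !mxE addrC addKr.
  by case: ifP => // _; case: ifP => // _; exact: vlt0.
case: bij => _ _ /(_ _ Uq)[z' Az' z'q].
have Xz' : defset_set X z' by case: Az' => _ [].
exists (SigSub (mem_set Xz')); split; first by rewrite /= -(GK z') ?inE// z'q.
have qE j : z' ord0 (enum_val j) = q ord0 j by rewrite -z'q mxE.
rewrite !contCE u0E v0E kuE kvE /= !qE !mxE eqxx /=.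
by rewrite ![w _ _ + _]addrC !addrK mulrC.
Qed.

End Realization.

(** * Functions with values in an orbit *)

Section DenseOrbit.
Variables (F : ov_field) (E : expansion F) (m : nat) (X : defset E m).
Implicit Types (f g h k p q s w e u v : contC X) (x y : X) (r z : carrier F).

(** Density of the points at which f reaches one of the two orbits; as in [slope_at], the sets |w| <
    |e| serve as neighbourhoods of the point coded by [q]. *)
Definition dense_orbits (a b c a' b' c' : contC X) f : Prop :=
  forall q w e, point_code q -> common_zero q w -> ~ common_zero q e ->
  exists p, point_code p /\ vlt_at p w e /\
    (reaches a b c p f \/ reaches a' b' c' p f).

Lemma dense_orbits_dpred (a b c a' b' c' : contC X) :
  dpred (contC_interp X) (fun env => dense_orbits a b c a' b' c' (env 0%N)).
Proof.
rewrite /dense_orbits /reaches /slope_at /vlt_at /vle_at /point_code /common_zero.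
dpred_tac.
Qed.

Definition dense_values (S : set (carrier F)) f : Prop :=
  forall x r, r != 0 -> exists y, oball (val x) r (val y) /\ S (f y).

(** By continuity f(x) is approached by values of f lying in S; as at most one element of S is
    within r of f(x), that element is f(x). *)
Lemma dense_values_separated (S : set (carrier F)) f x r : r != 0 ->
  (forall z z', S z -> S z' -> vlt (z - f x) r -> vlt (z' - f x) r -> z = z') ->
  dense_values S f -> S (f x).
Proof.
move=> r0 sep dense.
have near t : t != 0 -> exists2 y, S (f y) & vlt (f y - f x) t.
  move=> t0; have /continuous_vlt/(_ x t t0)/nbhs_defset[s s0 sP] :=
    contC_continuous (f := f).
  by have [y [xy Sy]] := dense x s s0; exists y => //; exact: sP.
have [y Sy yr] := near r r0; have [<-//|yx] := eqVneq (f y) (f x).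
have yx0 : f y - f x != 0 by rewrite subr_eq0.
(* A second value in S strictly closer to f(x) than f(y) would have to equal f(y). *)
have [t t0 tP] := vlt_min r0 yx0; have [y' Sy' /tP[y'r]] := near t t0.
by rewrite (sep _ _ Sy' Sy y'r yr) => -[yy]; case.
Qed.

Definition orbit_of (a b c : carrier F) : set (carrier F) :=
  range (fun n => iter n (fun z => a * z + b) c).

Hypothesis hFin : forall S : set (carrier F), definable1 (full_interp E) S ->
  closed S -> ov_bounded S -> isolated S = S -> finite_set S.

Lemma dense_orbits_sound (a b c a' b' c' : contC X)
    (al be ga al' be' ga' : carrier F) f :
  (forall x, [/\ a x = al, b x = be & c x = ga]) ->
  (forall x, [/\ a' x = al', b' x = be' & c' x = ga']) ->
  injective (fun n => iter n (fun z => al * z + be) ga) ->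
  injective (fun n => iter n (fun z => al' * z + be') ga') ->
  dense_orbits a b c a' b' c' f ->
  dense_values (orbit_of al be ga `|` orbit_of al' be' ga') f.
Proof.
move=> abc abc' inj inj' dense x r r0.
have [k kx kP] := contC_dist x; have [t t0 tP] := kP r r0.
have [e eE] := contC_cst X t; have [q qx] := codes_exist x.
have [||| p [/point_codeP[y py] [/(codes_vlt _ _ py) H reach]]] := dense q k e.
- by apply/point_codeP; exists x.
- exact/(codes_zero _ qx).
- by move=> /(codes_zero _ qx); rewrite eE => /eqP; rewrite (negbTE t0).
rewrite eE in H; exists y; split; first exact: tP.
have [aE bE cE] := abc y; have [aE' bE' cE'] := abc' y.
case: reach => reach; [left|right].
  have [|n ->] := reaches_sound hFin _ py reach; first by rewrite aE bE cE.
  by exists n => //; rewrite aE bE cE.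
have [|n ->] := reaches_sound hFin _ py reach; first by rewrite aE' bE' cE'.
by exists n => //; rewrite aE' bE' cE'.
Qed.

Lemma dense_orbits_complete (a b c a' b' c' : contC X)
    (al be ga al' be' ga' : carrier F) f :
  (forall x, [/\ a x = al, b x = be & c x = ga]) ->
  (forall x, [/\ a' x = al', b' x = be' & c' x = ga']) ->
  (forall x r, r != 0 -> exists y, oball (val x) r (val y) /\ planar y) ->
  (forall x, (orbit_of al be ga `|` orbit_of al' be' ga') (f x)) ->
  dense_orbits a b c a' b' c' f.
Proof.
move=> abc abc' dense forb q w e /point_codeP[x qx].
move=> /(codes_zero _ qx) wx; rewrite (codes_zero _ qx) => /eqP ex.
have [t t0 tP] := vlt_near ex.
have /continuous_vlt/(_ x t t0)/nbhs_defset[r1 r10 r1P] := contC_continuous (f := w).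
have /continuous_vlt/(_ x t t0)/nbhs_defset[r2 r20 r2P] := contC_continuous (f := e).
have [r r0 rP] := vlt_min r10 r20; have [y [xy ply]] := dense x r r0.
have [p py] := codes_exist y; exists p; split; first by apply/point_codeP; exists y.
have wy : vlt (w y - w x) t by apply: r1P => i; have /rP[] := xy i.
have ey : vlt (e y - e x) t by apply: r2P => i; have /rP[] := xy i.
split; first by apply/(codes_vlt _ _ py); apply: tP ey _; rewrite wx subr0 in wy.
have [aE bE cE] := abc y; have [aE' bE' cE'] := abc' y.
case: (forb y) => -[n _ fE]; [left|right]; apply: (reaches_complete ply py (n := n)).
  by rewrite aE bE cE.
by rewrite aE' bE' cE'.
Qed.

End DenseOrbit.

(** * Discreteness of the integers and of the powers of tau *)

Section Powers.
Variables (F : ov_field) (tau : carrier F).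
Hypotheses (tauO : unit_ball tau) (tau0 : tau != 0) (tauV : ~ unit_ball tau^-1).
Implicit Types (a b c r : carrier F) (k l : int) (n : nat).

Lemma vlt_tau1 : vlt tau 1.
Proof.
split; first by exists tau; rewrite ?mul1r.
by move=> [o oO tauo]; apply: tauV; rewrite -[tau^-1]mulr1 tauo mulKf.
Qed.

Lemma vlt_small r : r != 0 -> exists2 e, e != 0 & vlt e r.
Proof.
move=> r0; exists (r * tau); first by rewrite mulf_neq0.
by have /(vlt_pmull _ _ r0) := vlt_tau1; rewrite mulr1.
Qed.

Lemma vlt_expS n : vlt (tau ^+ n.+1) 1.
Proof.
apply: vle_vlt_trans vlt_tau1; exists (tau ^+ n); last by rewrite exprS.
by elim: n => [|n IH]; [exact: unit_ball1|rewrite exprS; exact: unit_ballM].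
Qed.

End Powers.

(** A gap uniform in n: d = 1 by the ultrametric inequality in the valued case, and d = 1 - |tau| in
    the ordered case, as |tau| < 1. *)
Lemma vle_1subX (F : ov_field) (tau : carrier F) :
  unit_ball tau -> tau != 0 -> ~ unit_ball tau^-1 ->
  exists2 d : carrier F, d != 0 & forall n, vle d (1 - tau ^+ n.+1).
Proof.
case: F tau => [R|K v] tau tauO tau0 tauV; last first.
  exists 1 => [|n]; first exact: oner_neq0.
  apply: contrapT => /not_vle tn.
  have := vlt_ultra tn (vlt_expS tauO tau0 tauV n).
  by rewrite subrK => -[tt]; exact.
have /vlt_ordered t1 := vlt_tau1 tauO tau0 tauV; rewrite normr1 in t1.
exists (1 - `|tau : R| : R) => [|n]; first by rewrite subr_eq0 eq_sym lt_eqF.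
have d0 : 0 <= 1 - `|tau : R| by rewrite subr_ge0 ltW.
apply/vle_ordered; rewrite ger0_norm//.
have le1 (s : R) : `|s| <= `|tau : R| -> 1 - `|tau : R| <= `|1 - s|.
  move=> st; apply: le_trans (lerB_dist 1 s); rewrite normr1.
  by rewrite lerD2l lerN2.
apply: le1; rewrite normrX exprS ler_piMr//.
by rewrite exprn_ile1// ltW.
Qed.

Section PowersSeparated.
Variables (F : ov_field) (tau : carrier F).
Hypotheses (tauO : unit_ball tau) (tau0 : tau != 0) (tauV : ~ unit_ball tau^-1).
Implicit Types (a b c r : carrier F) (k l : int) (n : nat).

Lemma exp_inj : injective (fun n => tau ^+ n).
Proof.
have [d d0 dP] := vle_1subX tauO tau0 tauV.
suff H i j : (i < j)%N -> tau ^+ i <> tau ^+ j.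
  by move=> i j /= ij; case: (ltngtP i j) => // /H []; rewrite ij.
move=> ilj; rewrite -(subnKC ilj) addSnnS; move: (j - i.+1)%N => n.
move/eqP; rewrite exprD -subr_eq0 -{1}[tau ^+ i]mulr1 -mulrBr mulf_eq0.
rewrite (negbTE (expf_neq0 _ tau0)) /= => /eqP n0.
by have [o _ dE] := dP n; move: d0; rewrite dE n0 mul0r eqxx.
Qed.

(** For k < l the difference of the two powers is tau^k times some 1 - tau^(n+1), so its size is at
    least that of d tau^k. Near c the size of tau^k is bounded below, so powers that close together
    are equal. The point 0 is excluded because powers may accumulate there. *)
Lemma expz_separated c : c != 0 -> exists2 r, r != 0 &
  forall k l, vlt (tau ^ k - c) r -> vlt (tau ^ l - c) r -> tau ^ k = tau ^ l.
Proof.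
move=> c0; have [d d0 dP] := vle_1subX tauO tau0 tauV.
have [t t0 tP] := vlt_near c0; have [s s0 sP] := vlt_mulr d^-1 t0.
have [r1 r10 r1P] := vlt_add s0; have [r r0 rP] := vlt_min r10 t0.
exists r => // k l.
wlog [n ->] : k l / exists n : nat, l = k + n%:Z.
  move=> H; case: (lerP k l) => [kl|/ltW lk] kr lr.
    by apply: H => //; exists `|l - k|%N; rewrite gez0_abs ?subr_ge0// subrKC.
  by apply/esym/H => //; exists `|k - l|%N; rewrite gez0_abs ?subr_ge0// subrKC.
case: n => [|n]; first by rewrite addr0.
move=> /rP[k1 kt] /rP[/vltN l1 _].
have := tP _ _ kt (sP _ (r1P _ _ k1 l1)).
have k0 : tau ^ k != 0 by rewrite expfz_neq0.
rewrite opprB addrA subrK expfzDr// -exprnP.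
rewrite -{1}[tau ^ k]mulr1 -mulrBr mulrCA -{2}[tau ^ k]mulr1 (vlt_pmull _ _ k0).
move=> /(vlt_pmull _ _ d0); rewrite mulVKf// mulr1 => -[_ []]; exact: dP.
Qed.

End PowersSeparated.

(** Two integers within 1/2 of the same point differ by less than 1. *)
Lemma int_separated (R : realFieldType) (c : carrier (OrderedField R)) :
  exists2 r : carrier (OrderedField R), r != 0 & forall k l : int,
    vlt (k%:~R - c) r -> vlt (l%:~R - c) r ->
    k%:~R = l%:~R :> carrier (OrderedField R).
Proof.
exists (2^-1 : R) => [|k l /vlt_ordered kc /vlt_ordered lc].
  by rewrite invr_eq0 pnatr_eq0.
suff -> : k = l by [].
have H (z : R) : `|k%:~R - z| < 2^-1 -> `|l%:~R - z| < 2^-1 -> k = l.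
  move=> kz lz; apply/eqP; rewrite -subr_eq0 -absz_eq0 -leqn0 -ltnS -ltz_nat abszE.
  rewrite -(ltr_int R) intr_norm rmorphB /=.
  apply: le_lt_trans (ler_distD z _ _) _; rewrite (distrC z).
  by rewrite [ltRHS](splitr 1) ltrD// mul1r.
have r2 : `|2^-1 : R| = 2^-1 by rewrite ger0_norm// invr_ge0 ler0n.
by rewrite r2 in kc lc; exact: (H c).
Qed.

(** * Definability of the functions with values in a union of two orbits *)

Section Main.
Variables (F : ov_field) (E : expansion F).
Hypothesis hDim : satisfies_Dim E.
Hypothesis hFin : forall S : set (carrier F), definable1 (full_interp E) S ->
  closed S -> ov_bounded S -> isolated S = S -> finite_set S.
Variables (tau : carrier F).
Hypotheses (tauO : unit_ball tau) (tau0 : tau != 0) (tauV : ~ unit_ball tau^-1).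
Variables (m d : nat) (X : defset E m).
Hypotheses (d2 : (2 <= d)%N) (hX : pure_dim X d).
Implicit Types f : contC X.

(** The density condition alone confines f to the closure of S. The definable set [U] contains the
    wanted functions and keeps the values of its members away from accumulation points of S, which
    excludes further limits. *)
Lemma orbits_definable (al be ga al' be' ga' : carrier F) (U : set (contC X)) :
  let S := orbit_of al be ga `|` orbit_of al' be' ga' in
  injective (fun n => iter n (fun z => al * z + be) ga) ->
  injective (fun n => iter n (fun z => al' * z + be') ga') ->
  dpred (contC_interp X) (fun e => U (e 0%N)) ->
  contC_into X S `<=` U ->
  (forall f x, U f -> exists2 r, r != 0 & forall z z', S z -> S z' ->
     vlt (z - f x) r -> vlt (z' - f x) r -> z = z') ->
  definable1 (contC_interp X) (contC_into X S).
Proof.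
move=> S inj inj' dU SU sep.
have [a aE] := contC_cst X al; have [a' aE'] := contC_cst X al'.
have [b bE] := contC_cst X be; have [b' bE'] := contC_cst X be'.
have [c cE] := contC_cst X ga; have [c' cE'] := contC_cst X ga'.
apply: dpred_definable1; apply: (dpred_iff (Q := fun e =>
  U (e 0%N) /\ dense_orbits a b c a' b' c' (e 0%N))); last first.
  by apply: dpred_and => //; exact: dense_orbits_dpred.
move=> e; split=> [Se|[Ue]].
  split; first exact: SU.
  apply: (@dense_orbits_complete _ _ _ _ _ _ _ _ _ _ al be ga al' be' ga') => //.
    by apply: planar_dense hDim _ d2 hX; exact: vlt_small tauO tau0 tauV.
  by move=> x; apply: Se; exists x.
move/(dense_orbits_sound hFin (fun x => And3 (aE x) (bE x) (cE x))
  (fun x => And3 (aE' x) (bE' x) (cE' x)) inj inj') => dense _ [x _ <-].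
have [r r0 rP] := sep _ x Ue.
exact: dense_values_separated r0 rP dense.
Qed.

Lemma powers_definable :
  definable1 (contC_interp X) (contC_into X (range (fun k : int => tau ^ k))).
Proof.
have iterE (a : carrier F) n : iter n (fun z => a * z + 0) 1 = a ^+ n.
  by elim: n => //= n ->; rewrite addr0 exprS.
have -> : range (fun k : int => tau ^ k) = orbit_of tau 0 1 `|` orbit_of tau^-1 0 1.
  apply/seteqP; split=> [_ [[n|n] _ <-]|z [] [n _ <-]].
  - by left; exists n => //; rewrite iterE.
  - by right; exists n.+1 => //; rewrite iterE NegzE exprVn.
  - by exists n%:Z => //; rewrite iterE.
  - by exists (- n%:Z) => //; rewrite iterE exprVn -exprnN.
have expE (z : carrier F) : (orbit_of tau 0 1 `|` orbit_of tau^-1 0 1) z ->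
    exists k : int, z = tau ^ k.
  move=> [] [n _ <-]; first by exists n%:Z; rewrite iterE.
  by exists (- n%:Z); rewrite iterE exprVn -exprnN.
(* Units of C(X) never vanish, so their values avoid 0, the only point at which the separation of
   the powers could fail. *)
apply: (orbits_definable (U := [set f | exists u, u * f = 1])) => /=.
- by move=> i j; rewrite !iterE; exact: exp_inj.
- by move=> i j; rewrite !iterE !exprVn => /invr_inj; exact: exp_inj.
- by dpred_tac.
- move=> f Sf; apply: contC_inv => x.
  by have [k ->] := expE (f x) (Sf _ (ex_intro2 _ _ x Logic.I erefl)); rewrite expfz_neq0.
- move=> f x [u /(congr1 (fun k => contC_fun k x))]; rewrite !contCE => uf.
  have fx0 : f x != 0.
    by apply/eqP => fx; move/eqP: uf; rewrite fx mulr0 eq_sym oner_eq0.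
  have [r r0 rP] := expz_separated tauO tau0 tauV fx0; exists r => //.
  by move=> z z' /expE[k ->] /expE[l ->]; exact: rP.
Qed.

End Main.

Lemma integers_definable (R : realFieldType) (E : expansion (OrderedField R))
    (hDim : satisfies_Dim E)
    (hFin : forall S : set (carrier (OrderedField R)), definable1 (full_interp E) S ->
      closed S -> ov_bounded S -> isolated S = S -> finite_set S)
    (tau : carrier (OrderedField R)) (tauO : unit_ball tau) (tau0 : tau != 0)
    (tauV : ~ unit_ball tau^-1)
    (m d : nat) (d2 : (2 <= d)%N) (X : defset E m) (hX : pure_dim X d) :
  definable1 (contC_interp X) (contC_into X (range (fun k : int => k%:~R))).
Proof.
have iterE (a : R) n : iter n (fun z => 1 * z + a) 0 = a *+ n :> R.
  by elim: n => //= n ->; rewrite mul1r mulrSr.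
have -> : range (fun k : int => k%:~R) =
    orbit_of (1 : carrier (OrderedField R)) 1 0 `|` orbit_of 1 (- 1) 0.
  apply/seteqP; split=> [_ [[n|n] _ <-]|z [] [n _ <-]].
  - by left; exists n => //; rewrite iterE.
  - by right; exists n.+1 => //; rewrite iterE NegzE mulrNz mulNrn.
  - by exists n%:Z => //; rewrite iterE.
  - by exists (- n%:Z) => //; rewrite iterE mulrNz mulNrn.
(* The integers are separated around every point, so [U] can be all of C(X). *)
apply: (orbits_definable hDim hFin tauO tau0 tauV d2 hX (U := setT)) => //.
- by move=> i j; rewrite !iterE => /eqP; rewrite eqr_nat => /eqP.
- by move=> i j; rewrite !iterE !mulNrn => /oppr_inj/eqP; rewrite eqr_nat => /eqP.
- by apply: dpred_const; exact: 0.
- move=> f x _; have [r r0 rP] := int_separated (f x); exists r => //.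
  have intE z : (orbit_of (1 : carrier (OrderedField R)) 1 0 `|` orbit_of 1 (- 1) 0) z ->
      exists k : int, z = k%:~R.
    move=> [] [n _ <-]; first by exists n%:Z; rewrite iterE.
    by exists (- n%:Z); rewrite iterE mulrNz mulNrn.
  by move=> z z' /intE[k ->] /intE[l ->]; exact: rP.
Qed.

Theorem theoremB (F : ov_field) (E : expansion F)
    (hDim : satisfies_Dim E)
    (hFin : forall S : set (carrier F), definable1 (full_interp E) S ->
      closed S -> ov_bounded S -> isolated S = S -> finite_set S)
    (tau : carrier F) (htauO : unit_ball tau) (htau0 : tau <> 0)
    (htauV : ~ unit_ball tau^-1)
    (m d : nat) (hd : (2 <= d)%N) (X : defset E m) (hX : pure_dim X d) :
  (is_ordered F ->
    definable1 (contC_interp X) (contC_into X (range (fun k : int => k%:~R)))) /\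
  definable1 (contC_interp X) (contC_into X (range (fun k : int => tau ^ k))).
Proof.
move/eqP in htau0; split; last first.
  exact: (powers_definable hDim hFin htauO htau0 htauV hd hX).
case: F E hDim hFin tau htauO htau0 htauV X hX => // R E hDim hFin tau tO t0 tV X hX _.
exact: (integers_definable hDim hFin tO t0 tV hd hX).
Qed.
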